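(* Let $f\colon\mathbb{F}\to\mathbb{H}$ be a relatively algebraically closed homomorphism from an algebraically closed field $\mathbb{F}$ to a hyperfield $\mathbb{H}$. Then for every homogeneous ideal $I\subseteq\mathbb{F}[X_0,X_1,\dots,X_n]$, $$f(PV(I)) = PV(f_*(I)).$$
   Context: **Hyperfields.** A hyperoperation on a set $H$ is a map $\boxplus$ from $H\times H$ to the non-empty subsets of $H$; for subsets, $A\boxplus B=\bigcup_{a\in A,b\in B}a\boxplus b$, singletons are identified with their elements, and longer hypersums are obtained by iteration. A hyperfield is a tuple $(\mathbb{H},\boxplus,\odot,0_{\mathbb H},1_{\mathbb H})$ such that: $\boxplus$ is an associative and commutative hyperoperation; $0_{\mathbb H}\boxplus a=a$; each $a$ has a unique $-a$ with $0_{\mathbb H}\in a\boxplus(-a)$; $a\in b\boxplus c$ iff $c\in a\boxplus(-b)$; $\mathbb{H}^\times:=\mathbb{H}\setminus\{0_{\mathbb H}\}$ is an abelian group under the single-valued operation $\odot$ with identity $1_{\mathbb H}$; $a\odot(b\boxplus c)=(a\odot b)\boxplus(a\odot c)$; and $0_{\mathbb H}\odot a=0_{\mathbb H}$. Every field is a hyperfield with $a\boxplus b=\{a+b\}$. **Homomorphisms.** A hyperfield homomorphism $f\colon\mathbb{H}_1\to\mathbb{H}_2$ is a map with $f(a\boxplus_1 b)\subseteq f(a)\boxplus_2 f(b)$, $f(a\odot_1 b)=f(a)\odot_2 f(b)$, $f(0)=0$, $f(1)=1$. **Polynomials.** $\mathbb{H}[X_0,\dots,X_n]$ is the set of formal expressions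 $p=\boxplus_{\mathbf{d}\in D}c_{\mathbf d}\odot \mathbf{X}^{\mathbf d}$ with $D$ a finite set of exponent vectors in $\mathbb{Z}_{\ge0}^{n+1}$ and $c_{\mathbf d}\in\mathbb{H}^\times$ (univariate polynomials $\mathbb{H}[X]$ similarly). Evaluation gives a subset $p(\mathbf a)=\boxplus_{\mathbf d\in D}c_{\mathbf d}\odot\mathbf a^{\mathbf d}\subseteq\mathbb{H}$ (equal to $\{0_{\mathbb H}\}$ if $D=\emptyset$), and $V(p)=\{\mathbf a\mid 0_{\mathbb H}\in p(\mathbf a)\}$. The push-forward of $p$ along $f$ is $f_*(p)=\boxplus_{\mathbf d\in D}f(c_{\mathbf d})\odot\mathbf X^{\mathbf d}$, and $f_*(I)=\{f_*(p)\mid p\in I\}$. For a set $J$ of polynomials, $V(J)=\bigcap_{p\in J}V(p)$. **RAC.** A surjective hyperfield homomorphism $f\colon\mathbb{H}_1\to\mathbb{H}_2$ is relatively algebraically closed if for every univariate polynomial $p\in\mathbb{H}_1[X]$ and every root $\beta\in V(f_*(p))$ there exists $\alpha\in f^{-1}(\beta)$ with $\alpha\in V(p)$. **Projective space.** $\mathbb{P}^n(\mathbb{H})=(\mathbb{H}^{n+1}\setminus\{(0,\dots,0)\})/\sim$, where $\mathbf a\sim\lambda\odot\mathbf a$ for $\lambda\in\mathbb{H}^\times$. For $I$ a homogeneous ideal over $\mathbb F$, $PV(I)=(V(I)\setminus\{(0,\dots,0)\})/\sim\ \subseteq\mathbb{P}^n(\mathbb{F})$ and $PV(f_*(I))=(V(f_*(I))\setminus\{(0,\dots,0)\})/\sim\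 \subseteq\mathbb{P}^n(\mathbb{H})$ (one may equivalently use only the push-forwards of homogeneous elements of $I$). The map $f$ acts on projective space coordinatewise, $f([a_0:\dots:a_n])=[f(a_0):\dots:f(a_n)]$. *)

(* Defs.v *)
From HB Require Import structures.
From mathcomp Require Import all_boot all_order all_algebra.
From mathcomp Require Import finmap boolp classical_sets.
From mathcomp Require Import mpoly.

Set Implicit Arguments.
Unset Strict Implicit.
Unset Printing Implicit Defensive.

Import GRing.Theory.

Local Open Scope classical_set_scope.

(* Extension of a hyperoperation to subsets, singletons being identified with
   their elements. *)
Definition setop (T : Type) (op : T -> T -> set T) (A B : set T) : set T :=
  \bigcup_(a in A) \bigcup_(b in B) op a b.

Record hyperfield := Hyperfield {
  hcarrier :> Type;
  hadd : hcarrier -> hcarrier -> set hcarrier;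
  hmul : hcarrier -> hcarrier -> hcarrier;
  hopp : hcarrier -> hcarrier;
  hzero : hcarrier;
  hone : hcarrier;
  hadd_neq0 : forall a b, hadd a b !=set0;
  haddA : forall a b c,
    setop hadd [set a] (hadd b c) = setop hadd (hadd a b) [set c];
  haddC : forall a b, hadd a b = hadd b a;
  hadd0 : forall a, hadd hzero a = [set a];
  hadd_opp : forall a b, hadd a b hzero <-> b = hopp a;
  hadd_rev : forall a b c, hadd b c a <-> hadd a (hopp b) c;
  (* the nonzero elements form an abelian group *)
  hone_neq0 : hone <> hzero;
  hmul_neq0 : forall a b, a <> hzero -> b <> hzero -> hmul a b <> hzero;
  hmulA_unit : forall a b c, a <> hzero -> b <> hzero -> c <> hzero ->
    hmul a (hmul b c) = hmul (hmul a b) c;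
  hmulC_unit : forall a b, a <> hzero -> b <> hzero -> hmul a b = hmul b a;
  hmul1_unit : forall a, a <> hzero -> hmul hone a = a;
  hmulV_unit : forall a, a <> hzero ->
    exists2 b, b <> hzero & hmul a b = hone;
  hmulDr : forall a b c,
    hmul a @` hadd b c = hadd (hmul a b) (hmul a c);
  hmul0 : forall a, hmul hzero a = hzero
}.

Arguments hzero {_}.
Arguments hone {_}.

Section HyperfieldTheory.
Variable H : hyperfield.
Implicit Types a b c : H.

Lemma hmulr0 a : hmul a hzero = hzero.
Proof.
have [->|a0] := pselect (a = hzero); first exact: hmul0.
have absorb b : hadd (hmul a hzero) (hmul a b) = [set hmul a b].
  by rewrite -hmulDr hadd0 image_set1.
apply: contrapT => x0; set x := hmul a hzero in absorb x0.
have [a' a'0 aa'] := hmulV_unit a0.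
have nx0 : hopp x <> hzero.
  move=> nx; have : hadd x (hopp x) hzero by apply/hadd_opp.
  by rewrite nx haddC hadd0 /=; apply: nesym.
have e : hmul a (hmul a' (hopp x)) = hopp x.
  by rewrite hmulA_unit // aa' hmul1_unit.
have : hadd x (hopp x) hzero by apply/hadd_opp.
by rewrite -{1}e absorb e /=; apply: nesym.
Qed.

Lemma hmulC a b : hmul a b = hmul b a.
Proof.
have [->|a0] := pselect (a = hzero); first by rewrite hmul0 hmulr0.
have [->|b0] := pselect (b = hzero); first by rewrite hmul0 hmulr0.
exact: hmulC_unit.
Qed.

Lemma hmulA a b c : hmul a (hmul b c) = hmul (hmul a b) c.
Proof.
have [->|a0] := pselect (a = hzero); first by rewrite !hmul0.
have [->|b0] := pselect (b = hzero); first by rewrite !(hmul0, hmulr0).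
have [->|c0] := pselect (c = hzero); first by rewrite !hmulr0.
exact: hmulA_unit.
Qed.

Lemma hmul1 a : hmul hone a = a.
Proof.
have [->|a0] := pselect (a = hzero); first exact: hmulr0.
exact: hmul1_unit.
Qed.

End HyperfieldTheory.

Definition hunit (H : hyperfield) : Type := {x : H | x <> hzero}.

Section FieldHyperfield.
Variable F : fieldType.
Local Open Scope ring_scope.

Definition field_hadd (a b : F) : set F := [set a + b].

Fact field_hadd_neq0 a b : field_hadd a b !=set0.
Proof. by exists (a + b). Qed.

Fact field_haddA a b c :
  setop field_hadd [set a] (field_hadd b c) =
  setop field_hadd (field_hadd a b) [set c].
Proof. by rewrite /setop /field_hadd !bigcup_set1 addrA. Qed.

Fact field_haddC a b : field_hadd a b = field_hadd b a.
Proof. by rewrite /field_hadd addrC. Qed.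

Fact field_hadd0 a : field_hadd 0 a = [set a].
Proof. by rewrite /field_hadd add0r. Qed.

Fact field_hadd_opp a b : field_hadd a b 0 <-> b = - a.
Proof.
split=> [/= /esym/eqP|->]; last by rewrite /field_hadd /= subrr.
by rewrite addrC addr_eq0 => /eqP.
Qed.

Fact field_hadd_rev a b c : field_hadd b c a <-> field_hadd a (- b) c.
Proof.
rewrite /field_hadd /=; split=> ->; last by rewrite addrC subrK.
by rewrite addrC addKr.
Qed.

Fact field_mul_neq0 (a b : F) : a <> 0 -> b <> 0 -> a * b <> 0.
Proof. by move=> /eqP a0 /eqP b0; apply/eqP; rewrite mulf_neq0. Qed.

Fact field_mulV (a : F) : a <> 0 -> exists2 b, b <> 0 & a * b = 1.
Proof.
by move=> /eqP a0; exists a^-1; [apply/eqP; rewrite invr_neq0|rewrite mulfV].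
Qed.

Fact field_mulDr a b c :
  *%R a @` field_hadd b c = field_hadd (a * b) (a * c).
Proof. by rewrite /field_hadd image_set1 mulrDr. Qed.

Definition field_hyperfield : hyperfield :=
  @Hyperfield F field_hadd *%R -%R 0 1
    field_hadd_neq0 field_haddA field_haddC field_hadd0 field_hadd_opp
    field_hadd_rev (elimN eqP (oner_neq0 F)) field_mul_neq0
    (fun a b c _ _ _ => mulrA a b c) (fun a b _ _ => mulrC a b)
    (fun a _ => mul1r a) field_mulV field_mulDr (@mul0r F).

End FieldHyperfield.

Record hyperhom (H1 H2 : hyperfield) := Hyperhom {
  hom_fun :> H1 -> H2;
  homD : forall a b, hom_fun @` hadd a b `<=` hadd (hom_fun a) (hom_fun b);
  homM : forall a b, hom_fun (hmul a b) = hmul (hom_fun a) (hom_fun b);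
  hom0 : hom_fun hzero = hzero;
  hom1 : hom_fun hone = hone
}.

Lemma hom_neq0 (H1 H2 : hyperfield) (f : hyperhom H1 H2) (a : H1) :
  a <> hzero -> f a <> hzero.
Proof.
move=> /hmulV_unit[b _ ab] fa0; apply: (@hone_neq0 H2).
by rewrite -(hom1 f) -ab homM fa0 hmul0.
Qed.

Definition hom_unit (H1 H2 : hyperfield) (f : hyperhom H1 H2) (c : hunit H1) :
  hunit H2 := exist _ (f (sval c)) (hom_neq0 (f := f) (svalP c)).

(* Formal polynomials: a finite set of exponents together with a nonzero
   coefficient for each of them. *)
Definition hpoly (H : hyperfield) : Type := {fmap nat -> hunit H}.
Definition hmpoly (n : nat) (H : hyperfield) : Type :=
  {fmap 'X_{1.. n} -> hunit H}.

Section Evaluation.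
Variable H : hyperfield.

(* By associativity and commutativity the order of s, hence the enumeration of
   the support in heval and hmeval, is irrelevant. *)
Definition hsum (s : seq H) : set H :=
  foldr (fun x A => setop (@hadd H) [set x] A) [set hzero] s.

Definition hpow (a : H) (k : nat) : H := iter k (hmul a) hone.

Definition hmonom (n : nat) (a : 'I_n -> H) (m : 'X_{1.. n}) : H :=
  \big[@hmul H/hone]_(i < n) hpow (a i) (m i).

Definition heval (p : hpoly H) (a : H) : set H :=
  hsum [seq hmul (sval (p d)) (hpow a (val d)) | d : domf p].

Definition hmeval (n : nat) (p : hmpoly n H) (a : 'I_n -> H) : set H :=
  hsum [seq hmul (sval (p d)) (hmonom a (val d)) | d : domf p].

Definition hroots (p : hpoly H) : set H := [set a | heval p a hzero].

Definition hmroots (n : nat) (p : hmpoly n H) : set ('I_n -> H) :=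
  [set a | hmeval p a hzero].

Definition hvariety (n : nat) (J : set (hmpoly n H)) : set ('I_n -> H) :=
  \bigcap_(p in J) hmroots p.

End Evaluation.

Section PushForward.
Variables (H1 H2 : hyperfield) (f : hyperhom H1 H2).

Definition hpush (p : hpoly H1) : hpoly H2 :=
  [fmap d : domf p => hom_unit f (p d)]%fset.

Definition hmpush (n : nat) (p : hmpoly n H1) : hmpoly n H2 :=
  [fmap d : domf p => hom_unit f (p d)]%fset.

Definition rel_alg_closed : Prop :=
  (forall b : H2, exists a : H1, f a = b) /\
  forall (p : hpoly H1) (b : H2), hroots (hpush p) b ->
    exists2 a : H1, f a = b & hroots p a.

End PushForward.

(* A point of projective space is an equivalence class of nonzero vectors for
   scaling by units, represented as the set of its elements. *)
Definition proj_class (H : hyperfield) (n : nat) (a : 'I_n.+1 -> H) :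
    set ('I_n.+1 -> H) :=
  [set b | exists l : hunit H, b = fun i => hmul (sval l) (a i)].

Definition proj_space (H : hyperfield) (n : nat) : Type :=
  {x : set ('I_n.+1 -> H) | exists2 a, a <> (fun=> hzero) & x = proj_class a}.

Lemma proj_classM (H : hyperfield) (n : nat) (a : 'I_n.+1 -> H) (l : hunit H) :
  proj_class (fun i => hmul (sval l) (a i)) = proj_class a.
Proof.
case: l => l l0 /=; apply/seteqP; split=> _ [[m m0] ->] /=.
  exists (exist _ (hmul m l) (hmul_neq0 m0 l0)) => /=.
  by apply/funext => i; rewrite hmulA.
have [k k0 lk] := hmulV_unit l0.
exists (exist _ (hmul m k) (hmul_neq0 m0 k0)) => /=; apply/funext => i.
by rewrite -hmulA (hmulA k) (hmulC k) lk hmul1.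
Qed.

Lemma proj_class_refl (H : hyperfield) (n : nat) (a : 'I_n.+1 -> H) :
  proj_class a a.
Proof.
by exists (exist _ hone (@hone_neq0 H)) => /=; apply/funext => i; rewrite hmul1.
Qed.

Lemma proj_class_eq (H : hyperfield) (n : nat) (a b : 'I_n.+1 -> H) :
  proj_class a = proj_class b <->
  exists l : hunit H, a = fun i => hmul (sval l) (b i).
Proof.
split=> [ab|[l ->]]; last exact: proj_classM.
by have : proj_class b a by rewrite -ab; exact: proj_class_refl.
Qed.

Section ProjectiveMap.
Variables (H1 H2 : hyperfield) (f : hyperhom H1 H2) (n : nat).

Definition proj_map_set (x : set ('I_n.+1 -> H1)) : set ('I_n.+1 -> H2) :=
  \bigcup_(a in x) proj_class (f \o a).

Lemma proj_map_class (a : 'I_n.+1 -> H1) :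
  proj_map_set (proj_class a) = proj_class (f \o a).
Proof.
apply/seteqP; split=> [b [_ [l ->]]|b ab]; last first.
  by exists a => //; exact: proj_class_refl.
have -> : f \o (fun i => hmul (sval l) (a i)) =
          fun i => hmul (sval (hom_unit f l)) ((f \o a) i).
  by apply/funext => i /=; rewrite homM.
by rewrite proj_classM.
Qed.

Fact proj_map_subproof (x : proj_space H1 n) :
  exists2 b, b <> (fun=> hzero) & proj_map_set (sval x) = proj_class b.
Proof.
have [a a0 ->] := svalP x; exists (f \o a); last exact: proj_map_class.
move=> fa0; apply: a0; apply/funext => i; apply: contrapT.
by move=> /(hom_neq0 (f := f)); apply; exact: (congr1 (@^~ i) fa0).
Qed.

Definition proj_map (x : proj_space H1 n) : proj_space H2 n :=
  exist _ (proj_map_set (sval x)) (proj_map_subproof x).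

End ProjectiveMap.

Arguments proj_map {H1 H2} f {n} x.

Definition proj_variety (H : hyperfield) (n : nat) (J : set (hmpoly n.+1 H)) :
    set (proj_space H n) :=
  [set x | exists a,
    [/\ hvariety J a, a <> (fun=> hzero) & sval x = proj_class a]].

Section FieldPolynomials.
Variables (F : fieldType) (n : nat).
Local Open Scope ring_scope.

Fact mcoeff_msupp_neq0 (p : {mpoly F[n]}) (d : [fset m in msupp p]%fset) :
  p@_(val d) <> 0.
Proof. by apply/eqP; rewrite -mcoeff_msupp; have := valP d; rewrite inE. Qed.

Definition hmpoly_of (p : {mpoly F[n]}) : hmpoly n (field_hyperfield F) :=
  [fmap d : [fset m in msupp p] =>
    exist _ p@_(val d) (@mcoeff_msupp_neq0 p d)]%fset.

Lemma hmeval_field (p : {mpoly F[n]}) (a : 'I_n -> F) :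
  @hmeval (field_hyperfield F) n (hmpoly_of p) a = [set p.@[a]].
Proof.
have hsumE (s : seq F) : @hsum (field_hyperfield F) s = [set \sum_(x <- s) x].
  elim: s => [|x s IHs]; first by rewrite big_nil.
  by rewrite big_cons /= IHs /setop !bigcup_set1.
have hpowE (x : F) k : @hpow (field_hyperfield F) x k = x ^+ k.
  by elim: k => [|k IHk]; rewrite ?expr0 // exprS -IHk.
rewrite /hmeval hsumE mevalE; congr [set _].
rewrite big_image /= (eq_bigr (fun d : [fset m in msupp p]%fset =>
  p@_(val d) * \prod_i a i ^+ (val d) i)).
  rewrite -(big_seq_fsetE _ [fset m in msupp p]%fset xpredT
    (fun m => p@_m * \prod_i a i ^+ m i)) /=.
  apply: perm_big; apply: uniq_perm; rewrite ?fset_uniq ?msupp_uniq //.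
  by move=> m; rewrite !inE.
move=> d _; rewrite ffunE /=; congr (_ * _).
by apply: eq_bigr => i _; rewrite hpowE.
Qed.

Definition is_ideal (I : set {mpoly F[n]}) : Prop :=
  [/\ I 0, forall p q, I p -> I q -> I (p + q) & forall p q, I q -> I (p * q)].

(* pihomog mdeg d p is the degree d homogeneous component of p. *)
Definition homogeneous_ideal (I : set {mpoly F[n]}) : Prop :=
  is_ideal I /\ forall p d, I p -> I (pihomog mdeg d p).

End FieldPolynomials.

(* The elements of I, seen as formal polynomials over F as a hyperfield; by
   hmeval_field their roots are the usual ones. *)
Definition ideal_hmpoly (F : fieldType) (n : nat) (I : set {mpoly F[n]}) :
  set (hmpoly n (field_hyperfield F)) := @hmpoly_of F n @` I.

Definition ideal_push (F : fieldType) (H : hyperfield)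
    (f : hyperhom (field_hyperfield F) H) (n : nat) (I : set {mpoly F[n]}) :
    set (hmpoly n H) :=
  @hmpush _ _ f n @` ideal_hmpoly I.

(* Main.v *)
Require Import Defs.
From HB Require Import structures.
From mathcomp Require Import all_boot all_order all_algebra.
From mathcomp Require Import closed_field.
From mathcomp Require Import finmap boolp classical_sets.
From mathcomp Require Import mpoly.
From mathcomp Require Import ring.

(** Everything about [H] is read off from the fibre [U] of [f] over [1].  Call
[s_1, ..., s_k] in [F] balanced if the hypersum of the [f s_i] contains [0].
Lifting the root [1] of a univariate polynomial with these coefficients shows
that a balanced sequence satisfies [sum_i s_i * t^i = 0] for some [t] in [U]
([balanced_root]), while a sequence of sum [0] is balanced.

The shape of [U].  Applied to the sequence [a, - l a, b, - l b], whose
polynomial is [(1 - l t) (a + b t^2)], the lifting property shows that the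
class modulo [U] of [a u + b v], for [u, v] in [U], is the class of [a + b],
unless [a] is in [- U b] ([sum_class_unique]).  This rigidity forces [U] to
come from a valuation ring [O] of [F] with maximal ideal [m]: either
[U = 1 + m] or [U] is the group of units of [O] ([fiber_valuation]).

Reduction to a special fibre.  Let [b] be a zero of the push-forward of [I]
and choose [a_i] with [f (a_i) = b_i].  A zero of [I] above [b] can be sought
in the form [(a_i x_i)] with [x_i] in [U], so [I] is replaced by its rescaled
ideal [J].  There is a point [c] with coordinates in [O] such that every
polynomial of [J] with coefficients in [O] vanishes at [c] modulo [m], and such
that [x_i = c_i] modulo [m] forces [x_i] into [U] when [a_i] is nonzero
([fiber_center]).  If [U = 1 + m] this is the indicator vector of the support
of [a].  If [U] is the unit group, [c] is obtained from the Nullstellensatz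
over the residue field ([residue_point]): the only obstruction would be a
polynomial of [J] over [O] congruent modulo [m] to a power of the product of the
variables in the support of [a], and its single unit coefficient contradicts
balancedness.

Lifting.  It remains to lift [c] to a zero of [J] in [F] ([lift_point]).  After
a linear change of coordinates [c] is [(0, ..., 0, 1)], and the proof is an
induction on the number of variables ([local_lift]).  Unless [c] is already a
zero, [J] contains a polynomial monic in the last variable, and Gauss's lemma
yields a monic [G] dividing all of [J] and a nonzero [b], free of the last
variable, with [b G] in [J] ([ideal_monic_factor]).  If some coefficient of [G]
is not in [O], some specialisation of [G] has a root outside [O], and
homogeneity scales it to a zero of [G] close to [c].  Otherwise [J] is replaced
by the ideal quotient [J : G], which contains [b] and its top form.  Scaled to be
nonzero modulo [m], this form takes a unit value at some direction; one projects
along it, lifts the image of [c] by induction, and lifts the result through the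
projection by the extension theorem of elimination theory ([ideal_common_root]). *)

Set Implicit Arguments.
Unset Strict Implicit.
Unset Printing Implicit Defensive.

Import GRing.Theory.
Local Open Scope ring_scope.

(** * Ideals and common roots of polynomials over a ring *)

Definition ideal (A : comNzRingType) (J : A -> Prop) : Prop :=
  [/\ J 0, forall p q, J p -> J q -> J (p + q) & forall p q, J q -> J (p * q)].

Lemma idealB (A : comNzRingType) (J : A -> Prop) p q :
  ideal J -> J p -> J q -> J (p - q).
Proof. by case=> _ JD JM Jp Jq; apply: JD => //; rewrite -mulN1r; apply: JM. Qed.

Lemma ideal_preim (A B : comNzRingType) (f : {rmorphism B -> A}) (J : A -> Prop) :
  ideal J -> ideal (fun x => J (f x)).
Proof.
case=> J0 JD JM; split=> [|p q|p q]; rewrite ?rmorph0 ?rmorphD ?rmorphM //.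
  exact: JD.
exact: JM.
Qed.

Lemma ideal_colon (A : comNzRingType) (J : A -> Prop) g :
  ideal J -> ideal (fun x => J (g * x)).
Proof.
case=> J0 JD JM; split=> [|p q|p q]; rewrite ?mulr0 ?mulrDr //.
  exact: JD.
by rewrite mulrCA; apply: JM.
Qed.

Lemma poly_ideal_min (R : nzRingType) (P : {poly R} -> Prop) :
  (exists2 p, P p & p != 0) ->
  exists g, [/\ P g, g != 0 & forall p, P p -> (size p < size g)%N -> p = 0].
Proof.
case=> p0 Pp0 p0N0.
have ex : exists k, `[< exists p, [/\ P p, p != 0 & size p = k] >].
  by exists (size p0); apply/asboolP; exists p0.
have [k /asboolP[g [Pg gN0 szg]] kmin] := ex_minnP ex.
exists g; split=> // p Pp; rewrite szg => ltpk; apply/eqP/contraT => pN0.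
have /kmin : `[< exists q, [/\ P q, q != 0 & size q = size p] >].
  by apply/asboolP; exists p.
by rewrite leqNgt ltpk.
Qed.

(** The extension theorem of elimination theory.  The images of the elements of
    [J] form an ideal of [K[X]]; it has a common root unless it contains [1],
    that is, unless some [h] in [J] maps to [1].  Then [h1 = r X^N + h] keeps the
    leading coefficient of [r], so the resultant of [r] and [h1], which lies in [J]
    and hence maps to [0], maps to the resultant of their images.  These images
    would have a common root, at which the image of [h1] is [1]. *)
Lemma ideal_common_root (R : comNzRingType) (K : closedFieldType)
    (f : {rmorphism R -> K}) (J : {poly R} -> Prop) (r : {poly R}) :
    (forall y, exists x, f x = y) -> ideal J ->
    J r -> f (lead_coef r) != 0 -> (forall a, J a%:P -> f a = 0) ->
  exists t, forall p, J p -> (map_poly f p).[t] = 0.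
Proof.
move=> fsurj Jid Jr lcr Jf; have [J0 JD JM] := Jid.
have rN0 : r != 0 by apply: contraNneq lcr => ->; rewrite lead_coef0 rmorph0.
have szr : (1 < size r)%N.
  rewrite ltnNge; apply: contra lcr => /size1_polyC e.
  by rewrite e lead_coefC Jf -?e.
have psurj (q : {poly K}) : exists p, map_poly f p = q.
  have [s Hs] := choice fsurj.
  exists (\poly_(i < size q) s q`_i); apply/polyP => i.
  rewrite coef_map coef_poly; case: ltnP => [_|/leq_sizeP-> //]; first exact: Hs.
  exact: rmorph0.
have [_ [[g Jg <-] gN0 gmin]] : exists g, [/\ (exists2 p, J p & map_poly f p = g),
    g != 0 & forall p, (exists2 q, J q & map_poly f q = p) ->
      (size p < size g)%N -> p = 0].
  apply: poly_ideal_min; exists (map_poly f r); first by exists r.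
  by rewrite -size_poly_eq0 size_map_poly_id0 // size_poly_eq0.
have gdvd p : J p -> (map_poly f g %| map_poly f p)%R.
  move=> Jp; rewrite /dvdp; apply/eqP/gmin; last by rewrite ltn_modp.
  have [q eq] := psurj (map_poly f p %/ map_poly f g).
  exists (p - q * g); first by apply: idealB => //; apply: JM.
  rewrite rmorphB rmorphM /= eq {1}(divp_eq (map_poly f p) (map_poly f g)).
  by rewrite addrC addKr.
have [/eqP szg|/closed_rootP[t gt]] := boolP (size (map_poly f g) == 1).
  have [c cN0 ec] := size_poly1P _ (introT eqP szg).
  have [d ed] := fsurj c^-1.
  pose h := d%:P * g; have Jh : J h by apply: JM.
  have eh : map_poly f h = 1.
    by rewrite rmorphM /= ec map_polyC /= ed -polyCM mulVf.
  (* [N] is taken large enough for the leading coefficient of [r] to be that of [h1]. *)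
  pose N := size h; pose h1 := r * 'X^N + h.
  have lth : (size h < size (r * 'X^N)%R)%N.
    by rewrite size_mulXn // -[X in (X < _)%N]addn0 ltn_add2l size_poly_gt0.
  have lch : lead_coef h1 = lead_coef r.
    by rewrite lead_coefDl // lead_coef_Mmonic ?monicXn.
  have szh1 : (1 < size h1)%N.
    by rewrite size_polyDl // size_mulXn // (leq_trans szr) // leq_addl.
  have lcP (p : {poly R}) : lead_coef (map_poly polyC p) = (lead_coef p)%:P.
    by rewrite lead_coef_map_inj //; apply: polyC_inj.
  (* The resultant is formed over [R[Y]], which contains [R], and specialised at [Y = 0]. *)
  have [u /= _ eu] := @resultant_in_ideal _ (map_poly polyC r) (map_poly polyC h1)
    (etrans (congr1 (ltn 1) (size_map_polyC _)) szr)
    (etrans (congr1 (ltn 1) (size_map_polyC _)) szh1).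
  pose rho := (resultant (map_poly polyC r) (map_poly polyC h1)).[0].
  have Jrho : J rho%:P.
    have map0K (p : {poly R}) :
        map_poly (horner_eval (0 : R)) (map_poly polyC p) = p.
      rewrite -map_poly_comp map_poly_id // => c' _ /=.
      by rewrite /horner_eval hornerC.
    have map0 (p q p' q' : {poly {poly R}}) :
        map_poly (horner_eval (0 : R)) (p * q + p' * q') =
        map_poly (horner_eval 0) p * map_poly (horner_eval 0) q +
        map_poly (horner_eval 0) p' * map_poly (horner_eval 0) q'.
      by rewrite rmorphD !rmorphM.
    have := congr1 (map_poly (horner_eval (0 : R))) eu.
    rewrite map0 !map0K map_polyC /= => ->; apply: (JD); apply: (JM) => //.
    by apply: JD => //; rewrite mulrC; apply: JM.
  have := Jf _ Jrho; rewrite /rho.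
  pose F0 : {rmorphism {poly R} -> K} := horner_eval (0 : K) \o map_poly f.
  have F0P (p : {poly R}) : map_poly F0 (map_poly polyC p) = map_poly f p.
    rewrite -map_poly_comp; apply: eq_map_poly => c' /=.
    by rewrite map_polyC /horner_eval hornerC.
  have F0C c' : F0 c'%:P = f c' by rewrite /F0 /= map_polyC /horner_eval hornerC.
  have -> : f (resultant (map_poly polyC r) (map_poly polyC h1)).[0] =
      F0 (resultant (map_poly polyC r) (map_poly polyC h1)).
    by rewrite /F0 /= /horner_eval -[in RHS](rmorph0 f) horner_map.
  rewrite map_resultant ?lcP ?F0C ?lch // !F0P => /eqP.
  rewrite resultant_eq0 => /gtn_eqF/negbT/closed_rootP[t].
  rewrite root_gcd => /andP[/rootP rt /rootP].
  rewrite rmorphD rmorphM /= eh !hornerE rt mul0r add0r => /eqP.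
  by rewrite oner_eq0.
by exists t => p /gdvd/dvdpP[q ->]; rewrite hornerM (rootP gt) mulr0.
Qed.

(** Gauss's lemma with [b] the product of the leading coefficients: a root [c] of
    [b] kills [G * H], hence [G] or [H], and [X - c] can be cancelled from that
    factor until [b] is constant. *)
Lemma dvd_content_monic (F : closedFieldType) (G H p : {poly {poly F}})
    (b : {poly F}) : b != 0 -> p \is monic -> b *: p = G * H ->
  forall j, (lead_coef G %| G`_j)%R.
Proof.
move=> bN0 pm; have [k] := ubnP (size b).
elim: k b bN0 G H => // k IHk b bN0 G H ltbk e.
have elc : b = lead_coef G * lead_coef H.
  by rewrite -lead_coefM -e lead_coefZ (monicP pm) mulr1.
have [/eqP sb|/closed_rootP[c bc]] := boolP (size b == 1).
  move=> j; have lcb : (lead_coef G %| b)%R by rewrite elc dvdp_mulIl.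
  by rewrite (dvdp_trans lcb) // (eqp_dvdl _ (_ : b %= 1)) ?dvd1p // -size_poly_eq1 sb.
have bc0 : b.[c] = 0 by apply/rootP.
have [b' eb'] := factor_theorem _ _ bc.
have XcN0 : 'X - c%:P != 0 :> {poly F} by rewrite polyXsubC_eq0.
have scI : injective (fun Q : {poly {poly F}} => ('X - c%:P) *: Q).
  by move=> P Q; rewrite -!mul_polyC; apply: mulfI; rewrite polyC_eq0.
have b'N0 : b' != 0 by apply: contraNneq bN0 => b0; rewrite eb' b0 mul0r.
have ltb'k : (size b' < k)%N.
  move: ltbk; rewrite eb' size_Mmonic ?monicXsubC // size_XsubC addn2 /=.
  by rewrite ltnS.
have divc (Q : {poly {poly F}}) : map_poly (horner_eval c) Q = 0 ->
    exists Q', Q = ('X - c%:P) *: Q'.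
  move=> Q0; exists (\poly_(i < size Q) (Q`_i %/ ('X - c%:P))).
  apply/polyP => i; rewrite coefZ coef_poly.
  case: ltnP => [_|/leq_sizeP-> //]; last by rewrite mulr0.
  rewrite mulrC divpK // dvdp_XsubCl; apply/rootP.
  by have := congr1 (fun q : {poly F} => q`_i) Q0; rewrite coef_map coef0.
have /eqP : map_poly (horner_eval c) G * map_poly (horner_eval c) H = 0.
  rewrite -rmorphM /= -e; apply/polyP => i.
  by rewrite coef_map coefZ /= /horner_eval hornerM bc0 mul0r coef0.
rewrite mulf_eq0 => /orP[] /eqP /divc[Q eQ] j.
  rewrite eQ lead_coefZ coefZ dvdp_mul2l //; apply: (IHk b' b'N0 Q H) => //.
  apply: scI; rewrite scalerA mulrC -eb' e eQ.
  by rewrite scalerAl.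
apply: (IHk b' b'N0 G Q) => //.
apply: scI; rewrite scalerA mulrC -eb' e eQ.
by rewrite scalerAr.
Qed.

(** * Multivariate polynomials and their restrictions to lines *)

(** Identities between ring morphisms out of a polynomial ring are checked on the
    generators; all compatibilities of substitutions below reduce to this. *)
Lemma mpoly_rmorph_ext (n : nat) (R : comNzRingType) (S : nzRingType)
    (f g : {rmorphism {mpoly R[n]} -> S}) :
    (forall c, f c%:MP = g c%:MP) -> (forall i, f 'X_i = g 'X_i) ->
  forall p, f p = g p.
Proof.
move=> fgC fgX p; rewrite (mpolyE p) !rmorph_sum; apply: eq_bigr => m _.
rewrite -mul_mpolyC !rmorphM /= fgC mpolyXE_id !rmorph_prod; congr (_ * _).
by apply: eq_bigr => i _; rewrite !rmorphXn /= fgX.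
Qed.

Lemma lift_max_widen (n : nat) (i : 'I_n) : lift ord_max i = widen_ord (leqnSn n) i.
Proof. by apply: val_inj; rewrite /= /bump leqNgt ltn_ord. Qed.

Lemma meval_muni (n : nat) (R : comNzRingType) (v : 'I_n.+1 -> R)
    (p : {mpoly R[n.+1]}) :
  p.@[v] = (map_poly (meval (v \o lift ord_max)) (muni p)).[v ord_max].
Proof.
rewrite muniE mevalE rmorph_sum horner_sum; apply: eq_bigr => m _ /=.
rewrite -!mul_polyC !rmorphM /= !map_polyC /= map_polyXn !hornerE mevalZ.
rewrite big_ord_recr /= mulrA; congr (_ * _ * _).
rewrite mevalX; apply: eq_bigr => i _.
by rewrite mnmE /= lift_max_widen; congr (v _ ^+ m _); apply: val_inj.
Qed.

Lemma mcoeff_muni (n : nat) (R : comNzRingType) (p : {mpoly R[n.+1]}) (m : 'X_{1..n.+1}) :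
  (muni p)`_(m ord_max) @_[multinom m (lift ord_max i) | i < n] = p@_m.
Proof.
rewrite muniE [p in RHS](mpolyE p) coef_sum !raddf_sum; apply: eq_bigr => k _ /=.
rewrite coefZ coefXn mulr_natr mcoeffMn !mcoeffZ !mcoeffX -mulrnAr -mulrnA mulnb.
congr (_ * (nat_of_bool _)%:R).
apply/andP/eqP => [[/eqP/mnmP ekm /eqP e]|->]; last first.
  by split=> //; apply/eqP/mnmP => i; rewrite !mnmE lift_max_widen; congr (m _); apply: val_inj.
apply/mnmP => i; case: (unliftP ord_max i) => [i' ->|-> //].
by have := ekm i'; rewrite !mnmE => <-; rewrite lift_max_widen; congr (k _); apply: val_inj.
Qed.

Lemma mpoly0_const (R : comNzRingType) (p : {mpoly R[0]}) : p = (p@_0)%:MP.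
Proof.
apply/mpolyP => m; have -> : m = 0%MM by apply/mnmP => -[].
by rewrite mcoeffC eqxx mulr1.
Qed.

Lemma mcoeff_pihomog (n : nat) (R : comNzRingType) d (p : {mpoly R[n]}) m :
  (pihomog mdeg d p)@_m = if mdeg m == d then p@_m else 0.
Proof.
rewrite pihomogE [p in RHS](mpolyE p) !raddf_sum /= big_mkcond /=.
rewrite -[RHS]mulrb; case: eqP => [<-|ne]; rewrite ?mulr1n ?mulr0n.
  apply: eq_bigr => k _; case: eqP => // ne.
  rewrite !mcoeffZ !mcoeffX; case: eqP => [ekm|]; last by rewrite mulr0.
  by rewrite ekm in ne.
apply: big1 => k _; case: eqP => // kd; rewrite mcoeffZ mcoeffX.
by case: eqP => [ekm|]; rewrite ?mulr0 //; rewrite ekm in kd.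
Qed.

(** The restriction of a polynomial to the line with origin [a] and direction [v],
    as a polynomial in the parameter.  The origin may live in an extension [R] of
    the coefficient ring: with [R] a polynomial ring it is a generic point. *)
Definition line (n : nat) (K R : comNzRingType) (iota : {rmorphism K -> R})
  (a : 'I_n -> R) (v : 'I_n -> K) : {mpoly K[n]} -> {poly R} :=
  mmap (polyC \o iota) (fun i => (a i)%:P + (iota (v i))%:P * 'X).

HB.instance Definition _ n K R iota a v :=
  GRing.RMorphism.copy (@line n K R iota a v) (@line n K R iota a v).

Section Line.
Variables (n : nat) (K R : comNzRingType) (iota : {rmorphism K -> R}).
Variables (a : 'I_n -> R) (v : 'I_n -> K).

Lemma lineC c : line iota a v c%:MP = (iota c)%:P.
Proof. exact: mmapC. Qed.

Lemma lineX i : line iota a v 'X_i = (a i)%:P + (iota (v i))%:P * 'X.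
Proof. by rewrite [LHS]mmapX mmap1U. Qed.

(** Only the monomials of degree [d] contribute to the coefficient of degree [d]
    of the parameter, and their contribution does not see the origin of the line.
    Directions off the zero locus of the top form thus give restrictions that are
    monic up to a constant. *)
Lemma line_top d p : (forall m, m \in msupp p -> (mdeg m <= d)%N) ->
  (size (line iota a v p) <= d.+1)%N /\
  (line iota a v p)`_d = iota (pihomog mdeg d p).@[v].
Proof.
move=> pd; set P := line _ _ _ p.
have szM (P1 P2 : {poly R}) (a1 a2 : nat) (c1 c2 : R) :
    (size P1 <= a1.+1)%N /\ P1`_a1 = c1 -> (size P2 <= a2.+1)%N /\ P2`_a2 = c2 ->
    (size (P1 * P2)%R <= (a1 + a2).+1)%N /\ (P1 * P2)`_(a1 + a2) = c1 * c2.
  move=> [s1 <-] [s2 <-]; split.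
    apply: leq_trans (size_polyMleq _ _) _.
    by rewrite -subn1 leq_subLR add1n -addSn -addnS leq_add.
  rewrite coefM.
  have a1lt : (a1 < (a1 + a2).+1)%N by rewrite ltnS leq_addr.
  rewrite (bigD1 (Ordinal a1lt)) //= addKn big1 ?addr0 // => i.
  rewrite -val_eqE /= neq_ltn => /orP[lti|lti].
    rewrite [P2`_ _]nth_default ?mulr0 // (leq_trans s2) //.
    by rewrite ltn_subRL -[X in (_ < X)%N]addnC addnC ltn_add2l.
  by rewrite [P1`_ _]nth_default ?mul0r // (leq_trans s1).
have szX m : let Q := mmap1 (fun i => (a i)%:P + (iota (v i))%:P * 'X) m in
    (size Q <= (mdeg m).+1)%N /\ Q`_(mdeg m) = iota (\prod_i v i ^+ m i).
  rewrite /mmap1 mdegE rmorph_prod /=.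
  have key (i : 'I_n) k : (size (((a i)%:P + (iota (v i))%:P * 'X) ^+ k)%R <= k.+1)%N /\
     (((a i)%:P + (iota (v i))%:P * 'X) ^+ k)`_k = iota (v i) ^+ k.
    elim: k => [|k IHk]; first by rewrite !expr0 size_polyC coef1; case: eqP.
    rewrite !exprS; apply: (szM _ _ 1%N k) => //; split.
      rewrite addrC mul_polyC; apply: leq_trans (size_polyD _ _) _.
      rewrite geq_max (leq_trans (size_scale_leq _ _)) ?size_polyX //.
      by rewrite (leq_trans (size_polyC_leq1 _)).
    by rewrite coefD coefC coefCM coefX mulr1 add0r.
  elim/big_rec3 : _ => [|i Q1 d1 Q2 _ IH].
    by rewrite size_poly1 coef1.
  by rewrite rmorphXn; apply: szM.
have -> : P = \sum_(m <- msupp p) (iota p@_m)%:P *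
    mmap1 (fun i => (a i)%:P + (iota (v i))%:P * 'X) m by [].
split.
  apply: leq_trans (size_sum _ _ _) _; apply/bigmax_leqP_seq => m mp _.
  rewrite mul_polyC (leq_trans (size_scale_leq _ _)) //.
  by have [+ _] := szX m => /leq_trans; apply; rewrite ltnS pd.
rewrite coef_sum pihomogE [meval _ _]raddf_sum [RHS]raddf_sum [RHS]big_mkcond /=.
apply: eq_big_seq => m mp /=; rewrite coefCM.
have [sm cm] := szX m.
have [<-|neq] := eqVneq (mdeg m) d; first by rewrite cm mevalZ mevalX rmorphM.
by rewrite nth_default ?mulr0 // (leq_trans sm) // ltn_neqAle neq pd.
Qed.

End Line.

Lemma map_line (n : nat) (K R S : comNzRingType) (iota : {rmorphism K -> R})
    (a : 'I_n -> R) (v : 'I_n -> K) (f : {rmorphism R -> S}) p :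
  map_poly f (line iota a v p) = line (f \o iota) (f \o a) v p.
Proof.
apply: (mpoly_rmorph_ext (f := map_poly f \o line iota a v)) => [c|i] /=.
  by rewrite lineC map_polyC lineC.
by rewrite lineX rmorphD rmorphM /= !map_polyC map_polyX lineX.
Qed.

Lemma horner_line (n : nat) (K R : comNzRingType) (iota : {rmorphism K -> R})
    (a : 'I_n -> R) (v : 'I_n -> K) (f : {rmorphism R -> K}) t p :
    (forall c, f (iota c) = c) ->
  (map_poly f (line iota a v p)).[t] = p.@[fun i => f (a i) + v i * t].
Proof.
move=> fK; rewrite map_line.
apply: (mpoly_rmorph_ext
  (f := horner_eval t \o line (f \o iota) (f \o a) v)) => [c|i] /=.
  by rewrite lineC /horner_eval hornerC /= fK mevalC.
by rewrite lineX /horner_eval !hornerE /= fK mevalXU.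
Qed.

(** * Valuation rings and integrality of coefficients *)

Definition valuation_ring (F : fieldType) (O : subringClosed F) : Prop :=
  forall x, x \notin O -> x^-1 \in O.

(** The maximal ideal of a valuation ring.  As [O] contains one of [x] and [x^-1],
    an [x] with [x^-1] outside [O] lies in [O]. *)
Definition vmax (F : fieldType) (O : subringClosed F) (x : F) : bool :=
  (x == 0) || (x^-1 \notin O).

Section Valuation.
Variables (F : fieldType) (O : subringClosed F).
Hypothesis Ov : valuation_ring O.

Lemma vmax0 : vmax O 0. Proof. by rewrite /vmax eqxx. Qed.

Lemma vmax_int x : vmax O x -> x \in O.
Proof.
case/orP => [/eqP->|]; first exact: rpred0.
by apply: contraR => /Ov.
Qed.

Lemma vmaxMl a x : a \in O -> vmax O x -> vmax O (a * x).
Proof.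
rewrite /vmax => aO; have [->|xN0] := eqVneq x 0; first by rewrite mulr0 eqxx.
have [->|aN0] := eqVneq a 0; first by rewrite mul0r eqxx.
rewrite /= mulf_eq0 (negPf xN0) (negPf aN0) /=; apply: contra => axO.
have -> : x^-1 = a * (a * x)^-1 by rewrite invfM mulrA mulfV // mul1r.
exact: rpredM.
Qed.

Lemma vmaxD x y : vmax O x -> vmax O y -> vmax O (x + y).
Proof.
have [->|xN0] := eqVneq x 0; first by rewrite add0r.
have [->|yN0] := eqVneq y 0; first by rewrite addr0.
wlog xyO : x y xN0 yN0 / x / y \in O => [th xm ym|].
  have [/th|/Ov] := boolP (x / y \in O); first exact.
  by rewrite invf_div => /th; rewrite addrC; apply.
move=> _; rewrite /vmax (negPf yN0) /=; apply: contraR; rewrite negb_or negbK.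
case/andP => xyN0 xyO'.
have -> : y^-1 = (x / y + 1) * (x + y)^-1.
  by rewrite -[X in x / y + X](mulfV yN0) -mulrDl mulrAC mulfV // mul1r.
by rewrite rpredM // rpredD // rpred1.
Qed.

Lemma vmaxN x : vmax O x -> vmax O (- x).
Proof. by move=> xm; rewrite -mulN1r vmaxMl // rpredN1. Qed.

Lemma vmaxB x y : vmax O x -> vmax O y -> vmax O (x - y).
Proof. by move=> xm ym; apply/vmaxD/vmaxN. Qed.

Lemma vmaxMr a x : a \in O -> vmax O x -> vmax O (x * a).
Proof. by rewrite mulrC; apply: vmaxMl. Qed.

Lemma vmax1 : vmax O 1 = false.
Proof. by rewrite /vmax oner_eq0 invr1 rpred1. Qed.

Lemma vmaxPn x : reflect (x != 0 /\ x^-1 \in O) (~~ vmax O x).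
Proof. by rewrite /vmax negb_or negbK; apply: andP. Qed.

Lemma vmaxDl_unit x y : vmax O y -> vmax O (x + y) = vmax O x.
Proof.
move=> ym; apply/idP/idP => [xym|xm]; last exact: vmaxD.
by rewrite -(addrK y x) vmaxB.
Qed.

Lemma vmax_inv x : x \notin O -> vmax O x^-1.
Proof. by rewrite /vmax invrK => ->; rewrite orbT. Qed.

(** Integral closedness: dividing the equation of [t] by a power of [t] writes [t] as a
    polynomial in [t^-1] over [O], and [t^-1] is in [O] if [t] is not. *)
Lemma int_root (p : {poly F}) t :
  p \is monic -> (forall i, p`_i \in O) -> root p t -> t \in O.
Proof.
move=> pm pO /rootP pt; apply: contraT => tO; rewrite -(negPf tO).
have t0 : t != 0 by apply: contraNneq tO => ->; rewrite rpred0.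
have tVO := Ov tO.
have szp : size p = (size p).-1.+1.
  by rewrite prednK // size_poly_gt0 monic_neq0.
move: pt; rewrite horner_coef szp big_ord_recr /= -lead_coefE (monicP pm) mul1r.
case: (size p).-1 => [|k].
  by rewrite big_ord0 add0r expr0 => /eqP; rewrite oner_eq0.
rewrite exprS => /eqP; rewrite addrC addr_eq0 => /eqP e.
have -> : t = - \sum_(i < k.+1) p`_i * t^-1 ^+ (k - i).
  apply: (mulIf (expf_neq0 k t0)); rewrite e mulNr mulr_suml; congr (- _).
  apply: eq_bigr => i _; rewrite -mulrA; congr (_ * _).
  have ik : (i <= k)%N by rewrite -ltnS.
  rewrite -[X in _ * t ^+ X](subnK ik) exprD mulrA -exprMn mulVf //.
  by rewrite expr1n mul1r.
by rewrite rpredN rpred_sum // => i _; rewrite rpredM // rpredX.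
Qed.

End Valuation.

Section Interpolation.
Variables (F : closedFieldType) (O : subringClosed F).
Hypothesis Ov : valuation_ring O.

Let spread (s : seq F) :=
  all (mem O) s && pairwise (fun x y => (x != y) && ((x - y)^-1 \in O)) s.

(** The residue field of [O] is infinite because it is algebraically closed: a root
    [t] of [1 + prod_y (X - y)] is integral, and its differences with the [y] are
    units as their product is [-1]. *)
Lemma spread_exists k : exists2 s, spread s & size s = k.
Proof.
elim: k => [|k [s /andP[sO sp] szs]]; first by exists [::].
have [s0|s_gt0] := posnP (size s).
  exists [:: 0]; rewrite /spread //= ?andbT ?rpred0 //.
  by rewrite -szs s0.
pose P : {poly F} := \prod_(y <- s) ('X - y%:P).
have Pm : P \is monic by apply: monic_prod_XsubC.
have szP : size P = (size s).+1 by rewrite size_prod_XsubC.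
have P1m : P + 1 \is monic.
  by rewrite monicE lead_coefDl ?size_poly1 ?szP ?ltnS // (monicP Pm).
have PO i : P`_i \in O.
  have /polyOverP : P \is a polyOver O.
    rewrite /P big_seq rpred_prod // => y /(allP sO) yO.
    by rewrite polyOverXsubC.
  exact.
have [t tP] : exists t, root (P + 1) t.
  apply/closed_rootP; by rewrite size_polyDl ?size_poly1 ?szP ?eqSS -?lt0n.
have tO : t \in O.
  apply: int_root P1m _ tP => // i; rewrite coefD rpredD // coef1.
  by case: eqP; rewrite ?rpred1 ?rpred0.
have Pt : \prod_(y <- s) (t - y) = -1.
  move/rootP: tP; rewrite hornerD horner_prod hornerC => /eqP.
  rewrite addr_eq0 => /eqP <-; apply: eq_bigr => y _.
  by rewrite hornerXsubC.
have key y : y \in s -> (t - y) != 0 /\ (t - y)^-1 \in O.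
  move=> ys; have ty0 : t - y != 0.
    apply/eqP => ty; move: Pt; rewrite (big_rem y) //= ty mul0r => /esym/eqP.
    by rewrite oppr_eq0 oner_eq0.
  split=> //; move: Pt; rewrite (big_rem y) //= => e.
  have -> : (t - y)^-1 = - \prod_(z <- rem y s) (t - z).
    by apply: (mulfI ty0); rewrite mulfV // mulrN e opprK.
  rewrite rpredN big_seq rpred_prod // => z /mem_rem /(allP sO) zO.
  by rewrite rpredB.
exists (t :: s); last by rewrite -szs.
rewrite /spread /= tO sO sp /= andbT.
by apply/allP => y /key[]; rewrite subr_eq0 => -> ->.
Qed.

Variable M : F -> Prop.
Hypothesis M0 : M 0.
Hypothesis MD : forall x y, M x -> M y -> M (x + y).
Hypothesis MZ : forall a x, a \in O -> M x -> M (a * x).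

Let MB x y : M x -> M y -> M (x - y).
Proof. by move=> Mx My; apply: MD => //; rewrite -mulN1r; apply: MZ; rewrite ?rpredN1. Qed.

(** Newton interpolation at points whose differences are units of [O] expresses the
    coefficients as [O]-linear combinations of values.  It is used with [M] the zero
    module, [O] and the maximal ideal. *)
Lemma poly_interp (q : {poly F}) :
  (forall x, x \in O -> M q.[x]) -> forall i, M q`_i.
Proof.
move=> Mq; have [s] := spread_exists (size q).
have {Mq} Mq x : x \in s -> all (mem O) s -> M q.[x].
  by move=> xs /allP/(_ x xs)/Mq.
case/andP => sO sp szq.
have {Mq} Mq x : x \in s -> M q.[x] by move=> xs; apply: Mq.
have {szq} : (size q <= size s)%N by rewrite szq.
elim: s => [|x s IHs] in q sO sp Mq *.
  by rewrite leqn0 size_poly_eq0 => /eqP-> i; rewrite coef0.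
move: sO sp => /= /andP[xO sO] /andP[/allP sx sp] szq i.
have /factor_theorem[q1 eq1] : root (q - q.[x]%:P) x.
  by rewrite /root hornerD hornerN hornerC subrr.
have {}eq1 : q = q1 * ('X - x%:P) + q.[x]%:P by rewrite -eq1 subrK.
have Mq1 j : M q1`_j.
  apply: IHs => // [y ys|].
    have /andP[xy yxO] := sx y ys.
    have -> : q1.[y] = - (x - y)^-1 * (q.[y] - q.[x]).
      have -> : q.[y] - q.[x] = q1.[y] * (y - x).
        by rewrite {1}eq1 !hornerE addrK.
      by rewrite -invrN opprB mulrC mulfK // subr_eq0 eq_sym.
    by apply: MZ; rewrite ?rpredN //; apply: MB; apply: Mq; rewrite inE ?eqxx ?ys ?orbT.
  have [->|q10] := eqVneq q1 0; first by rewrite size_poly0.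
  rewrite -ltnS; apply: leq_trans szq; rewrite {1}eq1 size_polyDl.
    by rewrite size_Mmonic ?monicXsubC // size_XsubC addn2.
  rewrite size_Mmonic ?monicXsubC // size_XsubC addn2 /=.
  by rewrite (leq_ltn_trans (size_polyC_leq1 _)) // ltnS size_poly_gt0.
rewrite eq1 coefD mulrBr coefB coefMX coefMC coefC.
apply: MD; last by case: ifP => // _; apply: Mq; rewrite inE eqxx.
apply: MB; first by case: ifP.
by rewrite mulrC; apply: MZ.
Qed.

Lemma mpoly_interp (n : nat) (p : {mpoly F[n]}) :
  (forall v, (forall i, v i \in O) -> M p.@[v]) -> forall m, M p@_m.
Proof.
elim: n p => [|n IHn] p Mp m.
  have -> : m = 0%MM by apply/mnmP => -[].
  by have := Mp (fun=> 0) (fun=> rpred0 _); rewrite {1}[p]mpoly0_const mevalC.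
rewrite -mcoeff_muni; apply: IHn => v vO.
have -> : ((muni p)`_(m ord_max)).@[v] = (map_poly (meval v) (muni p))`_(m ord_max).
  by rewrite coef_map.
apply: poly_interp => t tO.
pose w i := if unlift ord_max i is Some j then v j else t.
have -> : (map_poly (meval v) (muni p)).[t] = p.@[w].
  rewrite meval_muni /w unlift_none; congr (_.[_]); apply: eq_map_poly => q /=.
  by apply: meval_eq => i /=; rewrite liftK.
by apply: Mp => i; rewrite /w; case: unliftP.
Qed.

End Interpolation.

(** The ring is the whole field: with it, the interpolation lemmas specialise to the
    statement that a polynomial vanishing everywhere is zero. *)
Lemma trivial_valuation_ring (K : fieldType) :
  exists O : subringClosed K, valuation_ring O.
Proof.
have Kc : subring_closed (fun _ : K => true) by [].
pose O : subringClosed K := HB.pack (fun _ : K => true)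
  (GRing.isSubringClosed.Build K (fun _ => true) Kc).
by exists O.
Qed.

(** * The monic part of an ideal of polynomials *)

Lemma mpoly_eval_neq0 (K : closedFieldType) (n : nat) (p : {mpoly K[n]}) :
  p != 0 -> exists v, p.@[v] != 0.
Proof.
move=> pN0; apply: contrapT => nv.
have [T Tv] := trivial_valuation_ring K.
case/eqP: pN0; apply/mpolyP => m; rewrite mcoeff0.
apply: (mpoly_interp Tv (M := fun x => x = 0)) => //.
- by move=> x y -> ->; rewrite addr0.
- by move=> a x _ ->; rewrite mulr0.
by move=> v _; apply/eqP/contraT => pv; case: nv; exists v.
Qed.

Lemma mpoly_top (n : nat) (R : comNzRingType) (p : {mpoly R[n]}) : p != 0 ->
  exists2 d, forall m, m \in msupp p -> (mdeg m <= d)%N & pihomog mdeg d p != 0.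
Proof.
move=> pN0; exists (msize p).-1 => [m /msize_mdeg_lt|].
  by case: (msize p).
apply: contraTneq (mlead_supp pN0) => e.
have := congr1 (fun q => q@_(mlead p)) e; rewrite mcoeff_pihomog mcoeff0.
rewrite -(mlead_deg pN0) /= eqxx => /eqP.
by rewrite mcoeff_eq0.
Qed.

(** Divisibility can be tested on lines, even only on those where a given [e] does
    not vanish.  Along a direction [v] at which the top form of [b] does not vanish,
    and with a generic origin, [b] is monic up to a constant, so that [a] can be
    divided by it; a nonzero remainder would survive on some line with constant
    origin, against its degree. *)
Lemma mpoly_dvd_lines (K : closedFieldType) (n : nat)
    (a b e : {mpoly K[n]}) : b != 0 -> e != 0 ->
    (forall c v, let l := line (@idfun K : {rmorphism _ -> _}) c v in
      l b != 0 -> l e != 0 -> (l b %| l a)%R) ->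
  exists q, a = q * b.
Proof.
move=> bN0 eN0 dvdl; have [d bd topb] := mpoly_top bN0.
have [v vb] := mpoly_eval_neq0 topb.
pose iota := @mpolyC n K : {rmorphism K -> {mpoly K[n]}}.
(* The line with generic origin ['X_0, ..., 'X_(n-1)] and direction [v]. *)
pose L := line iota (fun i => 'X_i) v.
have [szB cB] := line_top iota (fun i => 'X_i) v bd.
rewrite -/L in szB cB.
set w := (pihomog mdeg d b).@[v] in vb cB.
have {}szB : size (L b) = d.+1.
  apply/eqP; rewrite eqn_leq szB ltnNge; apply/negP => /leq_sizeP/(_ d (leqnn _)).
  by rewrite cB => /eqP; rewrite mpolyC_eq0 (negPf vb).
pose B := (w^-1)%:MP *: L b.
have wE : (w^-1)%:MP * w%:MP = 1 :> {mpoly K[n]} by rewrite -mpolyCM mulVf.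
have szB' : (size B <= d.+1)%N by rewrite -szB size_scale_leq.
have Bm : B \is monic.
  have Bd : B`_d = 1 by rewrite coefZ cB.
  have szBd : size B = d.+1.
    apply/eqP; rewrite eqn_leq szB' ltnNge; apply/negP => /leq_sizeP/(_ d (leqnn _)).
    by rewrite Bd => /eqP; rewrite oner_eq0.
  by rewrite monicE lead_coefE szBd Bd.
have div := Pdiv.RingMonic.rdivp_eq Bm (L a).
set q := Pdiv.Ring.rdivp _ _ in div; set r := Pdiv.Ring.rmodp _ _ in div.
have szr : (size r < size B)%N by rewrite Pdiv.Ring.ltn_rmodpN0 // monic_neq0.
have r0 : r = 0.
  apply/polyP => i; rewrite coef0; apply/eqP/contraT => riN0.
  have /mpoly_eval_neq0[c] := mulf_neq0 riN0 eN0.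
  rewrite mevalM mulf_eq0 negb_or => /andP[ric ec].
  have evl p : map_poly (meval c) (L p) = line (@idfun K : {rmorphism _ -> _}) c v p.
    rewrite map_line; apply: (mpoly_rmorph_ext
      (f := line (meval c \o iota) (meval c \o (fun i => 'X_i)) v)) => [x|j] /=.
      by rewrite lineC /= mevalC lineC.
    by rewrite lineX /= mevalC mevalXU lineX.
  have lbN0 : line (@idfun K : {rmorphism _ -> _}) c v b != 0.
    rewrite -evl; apply/eqP => /(congr1 (fun p : {poly K} => p`_d)).
    by rewrite coef_map cB /= mevalC coef0 => /eqP; rewrite (negPf vb).
  have leN0 : line (@idfun K : {rmorphism _ -> _}) c v e != 0.
    apply: contraNneq ec => e0.
    have := horner_line (iota := @idfun K : {rmorphism _ -> _}) c v
      (f := @idfun K : {rmorphism _ -> _}) 0 e (fun=> erefl).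
    rewrite e0 rmorph0 horner0 => ->; apply/eqP/meval_eq => i0.
    by rewrite mulr0 addr0.
  have dvd_ba := dvdl c v lbN0 leN0; rewrite /= -!evl in dvd_ba.
  have eL : L b = w%:MP *: B by rewrite scalerA mulrC wE scale1r.
  have elb : map_poly (meval c) (L b) = w *: map_poly (meval c) B.
    by rewrite eL -mul_polyC rmorphM /= map_polyC /= mevalC mul_polyC.
  have ela : map_poly (meval c) (L a) =
      map_poly (meval c) q * map_poly (meval c) B + map_poly (meval c) r.
    by rewrite [in LHS]div rmorphD rmorphM.
  move: dvd_ba; rewrite [X in dvdp X _]elb [X in dvdp _ X]ela.
  rewrite (dvdpZl _ _ vb) dvdp_addr; last exact: dvdp_mulIr.
  move/dvdp_leq => dl.
  have rN0 : map_poly (meval c) r != 0.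
    by apply: contraNneq ric => rc0; rewrite -coef_map rc0 coef0.
  have := dl rN0; rewrite leqNgt => /negP[].
  apply: leq_ltn_trans (size_poly _ _) _.
  by rewrite size_map_poly_id0 ?(monicP Bm) ?rmorph1 ?oner_neq0.
(* At parameter [0] the line passes through its generic origin, so [L p] gives back [p]. *)
exists ((q * (w^-1)%:MP%:P).[0]).
have L0 p : (L p).[0] = p.
  apply: (mpoly_rmorph_ext
    (f := horner_eval (0 : {mpoly K[n]}) \o L) (g := idfun)) => [x|j] /=.
    by rewrite /L lineC /horner_eval hornerC.
  by rewrite /L lineX /horner_eval !hornerE.
have := congr1 (horner_eval 0) div; rewrite r0 addr0 /horner_eval L0 => ->.
by rewrite /B -mul_polyC mulrA hornerM L0.
Qed.

(** Gauss's lemma with several variables in the coefficients, from the case of a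
    single one by restriction to lines. *)
Lemma mpoly_content_monic (K : closedFieldType) (n : nat)
    (g h p : {poly {mpoly K[n]}}) (b : {mpoly K[n]}) :
    b != 0 -> p \is monic -> b *: p = g * h ->
  forall j, exists q, g`_j = q * lead_coef g.
Proof.
move=> bN0 pm e j.
have elc : b = lead_coef g * lead_coef h.
  by rewrite -lead_coefM -e lead_coefZ (monicP pm) mulr1.
move: (bN0); rewrite elc mulf_eq0 negb_or => /andP[lgN0 lhN0].
apply: (mpoly_dvd_lines lgN0 bN0) => c v /= lg lb.
set l := line _ _ _ in lg lb *.
have -> : l (lead_coef g) = lead_coef (map_poly l g).
  by rewrite lead_coef_map_eq.
have -> : l g`_j = (map_poly l g)`_j by rewrite coef_map.
apply: (dvd_content_monic (p := map_poly l p) (H := map_poly l h) lb).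
  exact: monic_map.
by rewrite -rmorphM -e -!mul_polyC rmorphM /= map_polyC.
Qed.

(** Over the fraction field [J] is principal.  A generator [g] of least degree divides
    the product of [p] by a power of its leading coefficient.  As [p] is monic,
    Gauss's lemma makes [g] the product of that coefficient and a monic [g1], by which
    exact division is possible. *)
Lemma ideal_monic_factor (K : closedFieldType) (n : nat)
    (J : {poly {mpoly K[n]}} -> Prop) (p : {poly {mpoly K[n]}}) :
    ideal J -> J p -> p \is monic ->
  exists g b, [/\ g \is monic, b != 0, J (b *: g) &
    forall q, J q -> exists h, q = h * g].
Proof.
move=> Jid Jp pm; have [J0 JD JM] := Jid.
have [|g [Jg gN0 gmin]] := @poly_ideal_min _ J.
  by exists p; rewrite ?monic_neq0.
have gdvd q : J q -> exists k, lead_coef g ^+ k *: q = Pdiv.Ring.rdivp q g * g.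
  move=> Jq; have e := Pdiv.ComRing.rdivp_eq g q.
  exists (Pdiv.Ring.rscalp q g); rewrite e.
  suff -> : Pdiv.Ring.rmodp q g = 0 by rewrite addr0.
  apply: gmin; last by rewrite Pdiv.Ring.ltn_rmodpN0.
  have -> : Pdiv.Ring.rmodp q g = lead_coef g ^+ Pdiv.Ring.rscalp q g *: q -
      Pdiv.Ring.rdivp q g * g by rewrite e addrC addKr.
  by apply: idealB => //; [rewrite -mul_polyC|]; apply: JM.
have lgN0 : lead_coef g != 0 by rewrite lead_coef_eq0.
have [k ek] := gdvd p Jp; rewrite mulrC in ek.
have [c cP] := choice (mpoly_content_monic (expf_neq0 k lgN0) pm ek).
pose g1 := \poly_(i < size g) c i.
have eg : g = lead_coef g *: g1.
  apply/polyP => i; rewrite coefZ coef_poly.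
  by case: ltnP => [_|/leq_sizeP->//]; rewrite ?mulr0 // mulrC -cP.
have g1N0 : g1 != 0 by apply: contraNneq gN0 => e; rewrite eg e scaler0.
have g1m : g1 \is monic.
  rewrite monicE; apply/eqP/(mulfI lgN0).
  by rewrite -lead_coefZ -eg mulr1.
exists g1, (lead_coef g); split=> //; first by rewrite -eg.
move=> q Jq; have [N eN] := gdvd q Jq.
have eq1 := Pdiv.RingMonic.rdivp_eq g1m q.
exists (Pdiv.Ring.rdivp q g1); rewrite {1}eq1.
suff -> : Pdiv.Ring.rmodp q g1 = 0 by rewrite addr0.
set r := Pdiv.Ring.rmodp _ _ in eq1 *.
have : lead_coef g ^+ N *: r = (lead_coef g *: Pdiv.Ring.rdivp q g -
    lead_coef g ^+ N *: Pdiv.Ring.rdivp q g1) * g1.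
  rewrite mulrBl -!scalerAl scalerAr -eg -eN -scalerBr; congr (_ *: _).
  by apply/esym/eqP; rewrite subr_eq addrC; apply/eqP.
move/(congr1 (fun u : {poly _} => size u)).
rewrite size_scale ?expf_neq0 //; set w := _ - _ => szr.
have szr1 : (size r < size g1)%N by rewrite Pdiv.Ring.ltn_rmodpN0.
have [w0|wN0] := eqVneq w 0.
  by apply/eqP; rewrite -size_poly_eq0 szr w0 mul0r size_poly0.
move: szr1; rewrite szr size_Mmonic // ltnNge.
by rewrite -(prednK (_ : 0 < size w)%N) ?size_poly_gt0 // addSn leq_addl.
Qed.

(** * Projection along a direction and the weak Nullstellensatz *)

Definition subst (n k : nat) (K : comNzRingType) (h : 'I_n -> {mpoly K[k]}) :
  {mpoly K[n]} -> {mpoly K[k]} := mmap (@mpolyC k K) h.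

HB.instance Definition _ n k K h :=
  GRing.RMorphism.copy (@subst n k K h) (@subst n k K h).

Section Subst.
Variables (n k : nat) (K : comNzRingType) (h : 'I_n -> {mpoly K[k]}).

Lemma substC c : subst h c%:MP = c%:MP. Proof. exact: mmapC. Qed.

Lemma substX i : subst h 'X_i = h i.
Proof. by rewrite [LHS]mmapX mmap1U. Qed.

Lemma meval_subst (v : 'I_k -> K) p :
  (subst h p).@[v] = p.@[fun i => (h i).@[v]].
Proof.
apply: (mpoly_rmorph_ext (f := meval v \o subst h)) => [c|i] /=.
  by rewrite substC !mevalC.
by rewrite substX mevalXU.
Qed.

Lemma subst_homog d p : (forall i, h i \is 1.-homog) -> p \is d.-homog ->
  subst h p \is d.-homog.
Proof.
move=> h1 /dhomogP pd.
have -> : subst h p = \sum_(m <- msupp p) (p@_m)%:MP * mmap1 h m by [].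
rewrite big_seq rpred_sum // => m mp; rewrite mul_mpolyC rpredZ //.
rewrite -(pd m mp : mdeg m = d).
rewrite /mmap1 mdegE; elim/big_rec2: _ => [|i d' q _ IH]; first exact: dhomog1.
by apply: dhomogM => //; rewrite -[X in X.-homog]mul1n; apply: dhomogMn.
Qed.

Lemma subst_over (S : subringClosed K) p : (forall i, h i \is a mpolyOver k S) ->
  p \is a mpolyOver n S -> subst h p \is a mpolyOver k S.
Proof.
move=> hS /mpolyOverP pS.
have -> : subst h p = \sum_(m <- msupp p) (p@_m)%:MP * mmap1 h m by [].
rewrite rpred_sum // => m _; rewrite rpredM ?mpolyOverC //.
by rewrite rpred_prod // => i _; rewrite rpredX.
Qed.

End Subst.

Lemma subst_comp (n k l : nat) (K : comNzRingType) (g : 'I_k -> {mpoly K[l]})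
    (h : 'I_n -> {mpoly K[k]}) p :
  subst g (subst h p) = subst (fun i => subst g (h i)) p.
Proof.
apply: (mpoly_rmorph_ext (f := subst g \o subst h)) => [c|i] /=.
  by rewrite substC !substC.
by rewrite substX substX.
Qed.

Lemma eq_subst (n k : nat) (K : comNzRingType) (g h : 'I_n -> {mpoly K[k]}) :
  g =1 h -> subst g =1 subst h.
Proof. by move=> gh p; have -> : g = h by apply/funext. Qed.

Lemma subst_id (n : nat) (K : comNzRingType) p :
  subst (fun i : 'I_n => 'X_i : {mpoly K[n]}) p = p.
Proof.
apply: (mpoly_rmorph_ext (f := subst _) (g := idfun)) => [c|i] /=; first by rewrite substC.
by rewrite substX.
Qed.

(** Common to the substitution of linear forms, with shift [0], and to the multiplication
    by a form of degree [s]. *)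
Lemma pihomog_additive (n k s : nat) (K : comNzRingType)
    (f : {additive {mpoly K[n]} -> {mpoly K[k]}}) :
    (forall d p, p \is d.-homog -> f p \is (d + s).-homog) ->
  forall d p, pihomog mdeg (d + s) (f p) = f (pihomog mdeg d p).
Proof.
move=> fh d p.
rewrite {1}(pihomog_partitionE (mf := mdeg) (leqnn (msize p))) (raddf_sum f).
rewrite [in LHS]raddf_sum /=.
have hom e : f (pihomog mdeg e p) \is (e + s).-homog by apply/fh/pihomogP.
have [ltdp|ledp] := ltnP d (msize p).
  rewrite (bigD1 (Ordinal ltdp)) //= pihomog_dE // big1 ?addr0 // => e ed.
  by apply: (pihomog_ne0 _ (hom e)); rewrite eqn_add2r -val_eqE in ed *.
rewrite big1 => [|e _]; last first.
  apply: (pihomog_ne0 _ (hom e)).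
  by rewrite eqn_add2r neq_ltn (leq_trans (ltn_ord e)).
have -> : pihomog mdeg d p = 0.
  apply/mpolyP => m; rewrite mcoeff_pihomog mcoeff0; case: eqP => // dm.
  by apply/memN_msupp_eq0/msize_mdeg_ge; rewrite dm.
by rewrite raddf0.
Qed.

Lemma pihomog_subst (n k : nat) (K : comNzRingType) (h : 'I_n -> {mpoly K[k]}) :
    (forall i, h i \is 1.-homog) ->
  forall d p, pihomog mdeg d (subst h p) = subst h (pihomog mdeg d p).
Proof.
move=> h1 d p; rewrite -[d in LHS]addn0.
apply: (pihomog_additive (f := subst h)) => e q qe.
by rewrite addn0; apply: subst_homog.
Qed.

Lemma pihomogM (n e : nat) (K : comNzRingType) (g : {mpoly K[n]}) :
    g \is e.-homog ->
  forall d p, pihomog mdeg (d + e) (g * p) = g * pihomog mdeg d p.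
Proof.
move=> ge d p; have fh e' q : q \is e'.-homog -> g * q \is (e' + e).-homog.
  by rewrite addnC; apply: dhomogM.
exact: (pihomog_additive (f := g \*o idfun) fh).
Qed.

Lemma meval_homog (n d : nat) (K : comNzRingType) (p : {mpoly K[n]}) c v :
  p \is d.-homog -> p.@[fun i => c * v i] = c ^+ d * p.@[v].
Proof.
move/dhomogP => pd; rewrite !mevalE mulr_sumr; apply: eq_big_seq => m mp.
rewrite -(pd m mp : mdeg m = d) mulrCA; congr (_ * _).
rewrite mdegE expr_sum -big_split /=; apply: eq_bigr => i _.
by rewrite exprMn.
Qed.

Lemma mpolyX_homog (n : nat) (K : nzRingType) (i : 'I_n) :
  'X_i \is [in K[n], 1.-homog].
Proof. by rewrite dhomogX; apply/eqP/mdeg1. Qed.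

Section Slice.
Variables (n : nat) (K : fieldType) (k : 'I_n.+1) (v : 'I_n.+1 -> K).
Hypothesis vk : v k != 0.

(** The linear forms [X_i - (v_i / v_k) X_k], for [i != k], vanish at [v]: they are
    coordinates on the quotient by the line spanned by [v], that is, the projection
    along [v].  They identify [{mpoly K[n]}] with the polynomials constant along
    [v]. *)
Definition slice (i : 'I_n) : {mpoly K[n.+1]} :=
  'X_(lift k i) - (v (lift k i) / v k) *: 'X_k.

Definition insert0 (R : zmodType) (x : 'I_n -> R) (i : 'I_n.+1) : R :=
  if unlift k i is Some j then x j else 0.

(** With [X_k / v_k] as the remaining coordinate, polynomials in [n.+1] variables
    become univariate polynomials over the polynomials constant along [v].  The
    inverse [along] restricts to a generic line of direction [v]. *)
Definition unalong : {poly {mpoly K[n]}} -> {mpoly K[n.+1]} :=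
  horner_eval ((v k)^-1 *: 'X_k) \o map_poly (subst slice).

HB.instance Definition _ := GRing.RMorphism.copy unalong unalong.

Definition along : {mpoly K[n.+1]} -> {poly {mpoly K[n]}} :=
  line (@mpolyC n K) (insert0 (fun i => 'X_i)) v.

HB.instance Definition _ := GRing.RMorphism.copy along along.

Lemma alongK p : unalong (along p) = p.
Proof.
apply: (mpoly_rmorph_ext (f := unalong \o along) (g := idfun)) => [c|i] /=.
  by rewrite /along lineC /unalong /= map_polyC /horner_eval hornerC /= substC.
rewrite /along lineX /unalong /= rmorphD rmorphM /= !map_polyC map_polyX /=.
rewrite /horner_eval !hornerE /= substC mul_mpolyC scalerA /insert0.
case: unliftP => [j ->|->]; first by rewrite substX /slice subrK.
by rewrite rmorph0 add0r mulfV // scale1r.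
Qed.

Lemma meval_unalong w (P : {poly {mpoly K[n]}}) :
  (unalong P).@[w] =
  (map_poly (meval (fun i => w (lift k i) - v (lift k i) / v k * w k)) P).[w k / v k].
Proof.
rewrite /unalong /= /horner_eval -horner_map /= mevalZ mevalXU mulrC; congr (_.[_]).
rewrite -map_poly_comp; apply: eq_map_poly => q /=; rewrite meval_subst.
by apply: meval_eq => i; rewrite /slice mevalB mevalZ !mevalXU.
Qed.

Lemma meval_along (x : 'I_n -> K) t p :
  (map_poly (meval x) (along p)).[t] = p.@[fun i => insert0 x i + v i * t].
Proof.
rewrite /along horner_line => [|c]; last exact: mevalC.
apply: meval_eq => i; rewrite /insert0.
by case: unliftP => [j _|_]; rewrite /= ?mevalXU ?meval0.
Qed.

Lemma slice_homog i : slice i \is 1.-homog.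
Proof. by rewrite /slice rpredB ?rpredZ ?mpolyX_homog. Qed.

End Slice.

(** A zero [x] of the polynomials of [J] constant along [v] lifts to a zero of [J] on
    the fibre of the projection above [x].  The hypothesis on [r] says that [r] is,
    up to a constant, monic along [v], as the extension theorem requires. *)
Lemma slice_elimination (K : closedFieldType) (n : nat) (k : 'I_n.+1)
    (v : 'I_n.+1 -> K) (J : {mpoly K[n.+1]} -> Prop) (d : nat) (r : {mpoly K[n.+1]})
    (x : 'I_n -> K) :
    v k != 0 -> ideal J -> J r ->
    (forall m, m \in msupp r -> (mdeg m <= d)%N) -> (pihomog mdeg d r).@[v] != 0 ->
    (forall q, J (subst (slice k v) q) -> q.@[x] = 0) ->
  exists t, forall p, J p -> p.@[fun i => insert0 k x i + v i * t] = 0.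
Proof.
move=> vk Jid Jr rd rv Jx.
have [sz lc] := line_top (@mpolyC n K) (insert0 k (fun i => 'X_i)) v rd.
rewrite -/(along k v r) /= in sz lc.
have [| | | | |t tP] := @ideal_common_root _ _ (meval x)
  (fun P => J (unalong k v P)) (along k v r).
- by move=> y; exists y%:MP; apply: mevalC.
- pose f : {rmorphism {poly {mpoly K[n]}} -> {mpoly K[n.+1]}} := unalong k v.
  exact (ideal_preim f Jid).
- by rewrite alongK.
- have sze : size (along k v r) = d.+1.
    apply/eqP; rewrite eqn_leq sz ltnNge; apply/negP => /leq_sizeP/(_ d (leqnn _)).
    by rewrite lc => /eqP; rewrite mpolyC_eq0 (negPf rv).
  by rewrite lead_coefE sze /= lc mevalC.
- move=> a Ja; apply: Jx; move: Ja.
  by rewrite /unalong /= map_polyC /horner_eval hornerC.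
exists t => p Jp; rewrite -meval_along; apply: tP.
by rewrite alongK.
Qed.

(** By induction on the number of variables, projecting along a direction at which the
    top form of some nonzero element of [J] does not vanish. *)
Lemma weak_nullstellensatz (K : closedFieldType) (n : nat)
    (J : {mpoly K[n]} -> Prop) :
  ideal J -> ~ J 1 -> exists x, forall p, J p -> p.@[x] = 0.
Proof.
elim: n J => [|n IHn] J Jid J1; have [J0 JD JM] := Jid.
  exists (fun=> 0) => p Jp; apply/eqP/contraT => pN0; case: J1.
  rewrite [p]mpoly0_const mevalC in pN0.
  have <- : (p@_0)^-1%:MP * p = 1 by rewrite {2}[p]mpoly0_const -mpolyCM mulVf.
  exact: JM.
have [all0|[r Jr rN0]] : (forall p, J p -> p = 0) \/ exists2 r, J r & r != 0.
  have [h|h] := pselect (exists2 r, J r & r != 0); first by right.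
  left=> p Jp; apply/eqP/contraT => pN0; case: h; by exists p.
  by exists (fun=> 0) => p /all0 ->; rewrite meval0.
have [d rd topr] := mpoly_top rN0.
have [v vr] := mpoly_eval_neq0 topr.
(* If [v = 0], the top form of [r] is constant, so [r] is, and [J] contains [1]. *)
have [k vk] : exists k, v k != 0.
  apply: contra_notP J1 => nk.
  have v0 i : v i = 0 by apply/eqP/contraT => vi; case: nk; exists i.
  have rtop : pihomog mdeg d r \is d.-homog by apply: pihomogP.
  case: d rd topr vr rtop => [|d] rd topr vr rtop.
    have er : r = (r@_0)%:MP.
      apply/mpolyP => m; rewrite mcoeffC; case: eqP => [<-|/eqP m0].
        by rewrite mulr1.
      rewrite mulr0; apply/memN_msupp_eq0/negP => /rd.
      by rewrite leqn0 mdeg_eq0 (negPf m0).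
    have r0 : r@_0 != 0 by apply: contraNneq rN0 => e; rewrite er e mpolyC0.
    have <- : (r@_0)^-1%:MP * r = 1 by rewrite {2}er -mpolyCM mulVf.
    exact: JM.
  move: vr; have -> : (pihomog mdeg d.+1 r).@[v] = 0 ^+ d.+1 * (pihomog mdeg d.+1 r).@[v].
    by rewrite -(meval_homog 0 v rtop); apply: meval_eq => i; rewrite v0 mul0r.
  by rewrite expr0n mul0r eqxx.
have [x xP] : exists x, forall q, J (subst (slice k v) q) -> q.@[x] = 0.
  pose pullback : {rmorphism {mpoly K[n]} -> {mpoly K[n.+1]}} := subst (slice k v).
  apply: IHn; first exact (ideal_preim pullback Jid).
  by rewrite rmorph1.
have [t tP] := slice_elimination vk Jid Jr rd vr xP.
by exists (fun i => insert0 k x i + v i * t).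
Qed.

(** * Homogeneous and primitive polynomials *)

Definition homog_closed (n : nat) (K : nzRingType) (J : {mpoly K[n]} -> Prop) :=
  forall d p, J p -> J (pihomog mdeg d p).

(** Sending [p] to [sum_j p_j T^j], with [p_j] the components of [p], is
    multiplicative, and a divisor of a constant times [T^d] is a constant times a
    power of [T]. *)
Lemma homog_factor (n d : nat) (K : idomainType) (g h : {mpoly K[n]}) :
  g * h != 0 -> g * h \is d.-homog -> exists e, g \is e.-homog.
Proof.
move=> ghN0 ghd.
(* The coefficient of [T^j] in [grade p] is the component of degree [j] of [p]. *)
pose grade := mmap (polyC \o @mpolyC n K) (fun i => ('X_i)%:P * 'X) :
  {mpoly K[n]} -> {poly {mpoly K[n]}}.
have gradeE p j : (grade p)`_j = pihomog mdeg j p.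
  have -> : grade p = \sum_(m <- msupp p) (p@_m)%:MP%:P *
    mmap1 (fun i => ('X_i)%:P * 'X) m by [].
  rewrite coef_sum pihomogE [RHS]big_mkcond; apply: eq_bigr => m _ /=.
  have -> : mmap1 (fun i => ('X_i : {mpoly K[n]})%:P * 'X) m =
      'X_[m] %:P * 'X^(mdeg m).
    rewrite /mmap1 mdegE mpolyXE_id rmorph_prod /= expr_sum -big_split /=.
    by apply: eq_bigr => i _; rewrite exprMn rmorphXn.
  rewrite mulrA -polyCM coefCM coefXn eq_sym mul_mpolyC.
  by case: eqP; rewrite ?mulr1 ?mulr0.
have egh : grade g * grade h = (g * h) *: 'X^d.
  have -> : grade g * grade h = grade (g * h) by rewrite /grade rmorphM.
  apply/polyP => j; rewrite gradeE coefZ coefXn.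
  have [->|jd] := eqVneq j d; first by rewrite mulr1 pihomog_dE.
  by rewrite mulr0 (pihomog_ne0 _ ghd) // eq_sym.
have : (grade g %| ('X - 0%:P) ^+ d)%R.
  by rewrite polyC0 subr0 -(dvdpZr _ _ ghN0) -egh dvdp_mulr.
case/dvdp_exp_XsubCP => e [_ /eqpP[[c1 c2] /andP[/= c1N0 _] ge]].
exists e; apply/dhomogP => m mg; apply/eqP/contraT => me.
have := congr1 (fun q : {poly _} => q`_(mdeg m)) ge.
rewrite !coefZ polyC0 subr0 coefXn (negPf me) mulr0 gradeE => /eqP.
rewrite mulf_eq0 (negPf c1N0) /= => /eqP/(congr1 (fun q => q@_m)).
rewrite mcoeff_pihomog eqxx mcoeff0 => /eqP.
by rewrite mcoeff_eq0 mg.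
Qed.

Section ValuedPolynomials.
Variables (F : closedFieldType) (O : subringClosed F).
Hypothesis Ov : valuation_ring O.

Lemma vmax_meval (n : nat) (p : {mpoly F[n]}) v w :
    p \is a mpolyOver n O -> (forall i, v i \in O) -> (forall i, w i \in O) ->
    (forall i, vmax O (v i - w i)) ->
  vmax O (p.@[v] - p.@[w]).
Proof.
move=> /mpolyOverP pO vO wO vw; rewrite !mevalE -sumrB.
apply: (big_ind (vmax O)) => [||m _]; [exact: vmax0|exact: vmaxD|].
rewrite -mulrBr vmaxMl //.
suff [] : [/\ \prod_(i < n) v i ^+ m i \in O, \prod_(i < n) w i ^+ m i \in O &
  vmax O (\prod_(i < n) v i ^+ m i - \prod_(i < n) w i ^+ m i)] by [].
have key a b c d : a \in O -> b \in O -> vmax O (a - b) ->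
    c \in O -> d \in O -> vmax O (c - d) ->
    [/\ a * c \in O, b * d \in O & vmax O (a * c - b * d)].
  move=> aO bO ab cO dO cd; split; rewrite ?rpredM //.
  have -> : a * c - b * d = a * (c - d) + d * (a - b) by ring.
  by apply: vmaxD => //; apply: vmaxMl.
have v1 : vmax O (1 - 1) by rewrite subrr vmax0.
elim/big_rec2: _ => [|i y x _ [yO xO yx]]; first by split; rewrite ?rpred1.
have [viO wiO viwi] : [/\ v i ^+ m i \in O, w i ^+ m i \in O &
    vmax O (v i ^+ m i - w i ^+ m i)].
  elim: (m i) => [|k [aO bO ab]]; first by rewrite !expr0 rpred1.
  by rewrite !exprS; apply: key.
exact: key.
Qed.

Lemma int_dominant (s : seq F) : has (predC1 0) s ->
  exists2 c, c \in s & c != 0 /\ forall x, x \in s -> x / c \in O.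
Proof.
elim: s => // a s IHs /=; have [s0 _|s0] := boolP (has (predC1 0) s); last first.
  rewrite orbF => a0; exists a; rewrite ?mem_head //; split=> // x.
  rewrite inE => /predU1P[->|xs]; first by rewrite mulfV // rpred1.
  move/hasPn/(_ _ xs): s0; rewrite /= negbK => /eqP->.
  by rewrite mul0r rpred0.
have [c cs [c0 cP]] := IHs s0.
have [acO|/Ov caO] := boolP (a / c \in O).
  exists c; rewrite ?inE ?cs ?orbT //; split=> // x; rewrite inE.
  by case/predU1P => [->|/cP].
have [a0|a0] := eqVneq a 0.
  exists c; rewrite ?inE ?cs ?orbT //; split=> // x; rewrite inE.
  by case/predU1P => [->|/cP //]; rewrite a0 mul0r rpred0.
exists a; rewrite ?mem_head //; split=> // x; rewrite inE => /predU1P[->|xs].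
  by rewrite mulfV // rpred1.
rewrite invf_div in caO.
have -> : x / a = x / c * (c / a) by rewrite mulrA mulfVK.
by rewrite rpredM // cP.
Qed.

(** Dividing by a coefficient of least valuation gives a polynomial over [O] that is
    nonzero modulo the maximal ideal, hence, the residue field being infinite,
    takes a unit value. *)
Lemma mpoly_primitive (n : nat) (p : {mpoly F[n]}) : p != 0 ->
  exists2 c, c != 0 & c *: p \is a mpolyOver n O /\
    exists v, (forall i, v i \in O) /\ ~~ vmax O (c *: p).@[v].
Proof.
move=> pN0; have : has (predC1 0) [seq p@_m | m <- msupp p].
  apply/hasP; exists p@_(mlead p); last by rewrite /= mleadc_eq0.
  by apply: map_f; apply: mlead_supp.
case/int_dominant => c /mapP[m0 m0p ec] [c0 cP].
exists c^-1; first by rewrite invr_eq0.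
have over : c^-1 *: p \is a mpolyOver n O.
  apply/mpolyOverP => m; rewrite mcoeffZ mulrC.
  have [mp|/memN_msupp_eq0->] := boolP (m \in msupp p); last by rewrite mul0r rpred0.
  by apply: cP; apply: map_f.
split=> //; apply: contrapT => nv.
have := @mpoly_interp F O Ov (fun x => vmax O x) (vmax0 O) (@vmaxD _ _ Ov)
  (@vmaxMl _ _) n (c^-1 *: p).
move=> /(_ _ m0); rewrite mcoeffZ -ec mulVf // vmax1 => H.
suff : false by []; apply: H => v vO; apply: contrapT => /negP pv.
by case: nv; exists v.
Qed.

End ValuedPolynomials.

(** * Lifting a point of the special fibre *)

Lemma poly_eq_eval (K : closedFieldType) (p q : {poly K}) :
  (forall t, p.[t] = q.[t]) -> p = q.
Proof.
move=> pq; apply/polyP => i; apply/eqP; rewrite -subr_eq0 -coefB; apply/eqP.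
have [T Tv] := trivial_valuation_ring K.
apply: (poly_interp Tv (M := fun x => x = 0)) => //.
- by move=> x y -> ->; rewrite addr0.
- by move=> a x _ ->; rewrite mulr0.
by move=> t _; rewrite hornerD hornerN pq subrr.
Qed.

(** The point [(x : 1)]; the last coordinate is the one that does not vanish. *)
Definition affine_point (n : nat) (R : nzRingType) (x : 'I_n -> R) (i : 'I_n.+1) : R :=
  if unlift ord_max i is Some j then x j else 1.

Section AffinePoint.
Variables (n : nat) (R : nzRingType) (x : 'I_n -> R).

Lemma affine_point_max : affine_point x ord_max = 1.
Proof. by rewrite /affine_point unlift_none. Qed.

Lemma affine_point_lift i : affine_point x (lift ord_max i) = x i.
Proof. by rewrite /affine_point liftK. Qed.

End AffinePoint.

Section LocalLift.
Variables (F : closedFieldType) (O : subringClosed F).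
Hypothesis Ov : valuation_ring O.

Let e (n : nat) : 'I_n.+1 -> F := affine_point (fun=> 0).

Let eN0 n : @e n ord_max != 0.
Proof. by rewrite /e affine_point_max oner_neq0. Qed.

Let meval_unalong_e n w (P : {poly {mpoly F[n]}}) :
  (unalong ord_max (@e n) P).@[w] =
  (map_poly (meval (fun i => w (lift ord_max i))) P).[w ord_max].
Proof.
rewrite meval_unalong /e affine_point_max divr1; congr (_.[_]).
apply: eq_map_poly => q /=; apply: meval_eq => i.
by rewrite affine_point_lift !mul0r subr0.
Qed.

(** A form of [J] which does not vanish at [e = (0, ..., 0, 1)] is, up to a constant,
    monic in the last variable, so the factorisation of ideals with a monic element
    applies to [J].  The common factor divides that form, hence is homogeneous, and
    its value at [e] is its leading coefficient. *)
Lemma common_factor (n : nat) (J : {mpoly F[n.+1]} -> Prop) p0 :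
    ideal J -> homog_closed J -> J p0 -> p0.@[e (n := n)] != 0 ->
  exists g b k, let G := unalong ord_max (@e n) g in
    [/\ g \is monic, b != 0 & J (G * subst (slice ord_max (@e n)) b)] /\
    [/\ forall p, J p -> exists h, p = h * G, G \is k.-homog & G.@[e (n := n)] = 1].
Proof.
move=> Jid Jh Jp0 p0e; have [J0 JD JM] := Jid.
(* Some homogeneous component of [p0] does not vanish at [e] either. *)
have [d p1e] : exists d, (pihomog mdeg d p0).@[e (n := n)] != 0.
  apply: contrapT => nd; case/eqP: p0e.
  rewrite (pihomog_partitionE (mf := mdeg) (leqnn (msize p0))) raddf_sum big1 // => d _.
  by apply/eqP/contraT => pd; case: nd; exists d.
set p1 := pihomog mdeg d p0 in p1e.
have Jp1 : J p1 by apply: Jh.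
have p1d : p1 \is d.-homog by apply: pihomogP.
have p1b m : m \in msupp p1 -> (mdeg m <= d)%N.
  by move=> mp; have /dhomogP p1h := p1d; rewrite (p1h m mp : mdeg m = d).
have [sz lc] := line_top (@mpolyC n F) (insert0 ord_max (fun i => 'X_i)) (@e n) p1b.
rewrite -/(along ord_max (@e n) p1) pihomog_dE //= in sz lc.
set c := p1.@[_] in p1e lc.
pose u : {poly {mpoly F[n]}} := (c^-1)%:MP *: along ord_max (@e n) p1.
have um : u \is monic.
  have ud : u`_d = 1 by rewrite coefZ lc -mpolyCM mulVf.
  have szu : size u = d.+1.
    apply/eqP; rewrite eqn_leq (leq_trans (size_scale_leq _ _)) //=.
    rewrite ltnNge; apply/negP => /leq_sizeP/(_ d (leqnn _)).
    by rewrite ud => /eqP; rewrite oner_eq0.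
  by rewrite monicE lead_coefE szu /= ud.
pose f : {rmorphism {poly {mpoly F[n]}} -> {mpoly F[n.+1]}} := unalong ord_max (@e n).
have fK p : f (along ord_max (@e n) p) = p by apply: alongK (eN0 n) p.
have Ju : J (f u) by rewrite /u -mul_polyC rmorphM fK; apply: JM.
have [g [b [gm b0 Jbg gdvd]]] := ideal_monic_factor (ideal_preim f Jid) Ju um.
have GE w : (f g).@[w] = (map_poly (meval (fun i => w (lift ord_max i))) g).[w ord_max].
  exact: meval_unalong_e.
have Gdvd p : J p -> exists h, p = h * f g.
  move=> Jp; have [|h eh] := gdvd (along ord_max (@e n) p); first by rewrite fK.
  by exists (f h); rewrite -rmorphM -eh fK.
have [k Gk] : exists k, f g \is k.-homog.
  have [h eh] := Gdvd p1 Jp1; apply: (@homog_factor _ d _ _ h); rewrite mulrC -eh //.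
  by apply: contraNneq p1e => p10; rewrite /c p10 meval0.
exists g, b, k; split; split=> //.
  have fb : f b%:P = subst (slice ord_max (@e n)) b.
    rewrite -[f _]/(unalong ord_max (@e n) b%:P) /unalong /=.
    by rewrite map_polyC /horner_eval hornerC.
  by rewrite mulrC -fb -[unalong _ _ g]/(f g) -rmorphM mul_polyC.
rewrite -[LHS]/((f g).@[e (n := n)]); set G := f g in Gk GE *.
(* On the last coordinate axis the form [G] is a constant times [X^k], and it is also monic. *)
pose P := map_poly (meval (fun _ : 'I_n => 0 : F)) g.
have Pm : P \is monic by apply: monic_map.
have PE : P = G.@[e (n := n)] *: 'X^k.
  apply: poly_eq_eval => t; rewrite hornerZ hornerXn mulrC -(meval_homog t _ Gk) GE.
  rewrite /e affine_point_max mulr1; congr (_.[_]); apply: eq_map_poly => q /=.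
  by apply: meval_eq => i; rewrite affine_point_lift mulr0.
by rewrite -[RHS](monicP Pm) PE lead_coefZ lead_coefXn mulr1.
Qed.

(** If [G] is not over [O], some specialisation of its first variables in [O] is a
    univariate monic polynomial not over [O], so has a root [t] outside [O].
    Dividing the coordinates by [t] moves them into the maximal ideal. *)
Lemma nonintegral_root (n k : nat) (g : {poly {mpoly F[n]}}) :
    let G := unalong ord_max (@e n) g in
    g \is monic -> G \is k.-homog -> G \isn't a mpolyOver _ O ->
  exists x, (forall i, vmax O (x i)) /\ G.@[affine_point x] = 0.
Proof.
move=> G gm Gk GO.
have [j gj] : exists j, g`_j \isn't a mpolyOver n O.
  apply: contrapT => nj; case/negP: GO.
  have gO j : g`_j \is a mpolyOver n O by apply: contraT => gj; case: nj; exists j.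
  have eO i : @e n i \in O by rewrite /e /affine_point; case: unliftP => *; rewrite ?rpred0 ?rpred1.
  have XO i : ('X_i : {mpoly F[n.+1]}) \is a mpolyOver _ O by apply: mpolyOverX.
  rewrite /G /unalong /= /horner_eval horner_coef rpred_sum // => i _.
  rewrite coef_map rpredM ?rpredX // /e ?affine_point_max ?invr1 ?scale1r //.
  apply: subst_over => // j; rewrite /slice rpredB ?mpolyOverZ //.
  by rewrite affine_point_max divr1 affine_point_lift rpred0.
have [v [vO gjv]] : exists v, (forall i, v i \in O) /\ (g`_j).@[v] \notin O.
  apply: contrapT => nv; case/negP: gj; apply/mpolyOverP => m.
  apply: (mpoly_interp Ov (M := fun x => x \in O)); first exact: rpred0.
  - by move=> x y; apply: rpredD.
  - by move=> x y; apply: rpredM.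
  by move=> v vO; apply: contraT => gv; case: nv; exists v.
pose P := map_poly (meval v) g.
have Pm : P \is monic by apply: monic_map.
have [t Pt tO] : exists2 t, root P t & t \notin O.
  have [s es] := closed_field_poly_normal P; rewrite (monicP Pm) scale1r in es.
  apply: contrapT => nt; case/negP: gjv; rewrite -coef_map -/P es.
  suff /polyOverP : \prod_(z <- s) ('X - z%:P) \is a polyOver O by apply.
  rewrite big_seq rpred_prod // => z zs; rewrite polyOverXsubC.
  by apply: contraT => zO; case: nt; exists z; rewrite // es root_prod_XsubC.
have t0 : t != 0 by apply: contraNneq tO => ->; rewrite rpred0.
exists (fun i => v i / t); split=> [i|]; first by rewrite vmaxMl // vmax_inv.
pose w i := t * affine_point (fun i => v i / t) i.
have <- : G.@[fun i => t^-1 * w i] = G.@[affine_point (fun i => v i / t)].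
  by apply: meval_eq => i; rewrite /w mulKf.
rewrite (meval_homog _ _ Gk) meval_unalong_e.
have -> : w ord_max = t by rewrite /w affine_point_max mulr1.
have -> : map_poly (meval (fun i => w (lift ord_max i))) g = P.
  apply: eq_map_poly => q /=; apply: meval_eq => i.
  by rewrite /w affine_point_lift mulrC divfK.
by rewrite (rootP Pt) mulr0.
Qed.

(** The dichotomy of the induction.  Either [e] can be lifted at once, being a zero of
    [J] or close to a zero of the common factor [G] of [J]; or [G] is over [O] and is
    [1] at [e], so that the larger ideal [J' = (J : G)] still reduces to zero at [e].
    It contains a form [r] in the first [n] variables, over [O], with a unit value
    at some [v].  As [r] vanishes at [0] modulo the maximal ideal, [v] has a unit
    coordinate. *)
Lemma local_lift_step (n : nat) (J : {mpoly F[n.+1]} -> Prop) :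
    ideal J -> homog_closed J ->
    (forall p, J p -> p \is a mpolyOver _ O -> vmax O p.@[affine_point (fun=> 0)]) ->
  (exists x : 'I_n -> F,
    (forall i, vmax O (x i)) /\ forall p, J p -> p.@[affine_point x] = 0) \/
  exists (J' : {mpoly F[n.+1]} -> Prop) (d : nat) (r : {mpoly F[n]}) v i0,
    [/\ ideal J', homog_closed J', forall p, J p -> J' p &
      forall p, J' p -> p \is a mpolyOver _ O -> vmax O p.@[affine_point (fun=> 0)]] /\
    [/\ J' (subst (fun i => 'X_(lift ord_max i)) r), r \is d.-homog,
      r \is a mpolyOver n O, ~~ vmax O r.@[v] &
      (forall i, v i \in O) /\ ~~ vmax O (v i0)].
Proof.
move=> Jid Jh Je; have [J0 JD JM] := Jid.
have [[p0 Jp0 p0e]|all0] := pselect (exists2 p, J p & p.@[e (n := n)] != 0); last first.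
  left; exists (fun=> 0); split=> [i|p Jp]; first exact: vmax0.
  by apply/eqP/contraT => pe; case: all0; exists p.
have [g [b [k /= [[gm b0 Jb] [Gdvd Gk Ge]]]]] := common_factor Jid Jh Jp0 p0e.
set G := unalong _ _ g in Jb Gdvd Gk Ge.
have [GO|GO] := boolP (G \is a mpolyOver _ O); last first.
  have [x [xm Gx]] := nonintegral_root gm Gk GO; left; exists x; split=> // p.
  by case/Gdvd => h ->; rewrite mevalM Gx mulr0.
right; exists (fun h => J (G * h)).
have [d _ topb] := mpoly_top b0.
have [c c0 [rO [v [vO rv]]]] := mpoly_primitive Ov topb.
set r := c *: _ in rO rv; exists d, r, v.
have rd : r \is d.-homog by rewrite rpredZ // pihomogP.
have J'id : ideal (fun h => J (G * h)) by apply: ideal_colon.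
have J'h : homog_closed (fun h => J (G * h)).
  by move=> d' h Jh'; rewrite -(pihomogM Gk); apply: Jh.
have J'e p : J (G * p) -> p \is a mpolyOver _ O -> vmax O p.@[e (n := n)].
  move=> JGp pO; rewrite -[p.@[_]]mul1r -Ge -mevalM; apply: Je => //.
  exact: rpredM.
have sliceE : slice ord_max (@e n) = fun i => 'X_(lift ord_max i).
  apply/funext => i.
  by rewrite /slice /e affine_point_lift mul0r scale0r subr0.
have J'r : J (G * subst (fun i => 'X_(lift ord_max i)) r).
  rewrite -sliceE /r -mul_mpolyC rmorphM /= substC mulrCA; apply: JM.
  rewrite -pihomog_subst; last exact: slice_homog.
  exact: J'h.
have [i0 vi0] : exists i, ~~ vmax O (v i).
  apply: contrapT => nv; case/negP: rv.
  have vm i : vmax O (v i) by apply: contraT => vi; case: nv; exists i.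
  rewrite -(vmaxDl_unit Ov _ (y := - r.@[fun=> 0])).
    apply: (vmax_meval Ov) => // i; first exact: rpred0.
    by rewrite subr0.
  apply: vmaxN; have := J'e _ J'r; rewrite meval_subst.
  have -> : r.@[fun i => ('X_(lift ord_max i)).@[e (n := n)]] = r.@[fun=> 0].
    by apply: meval_eq => i; rewrite mevalXU /e affine_point_lift.
  by apply; apply: subst_over => // i; apply: mpolyOverX.
exists i0; split; split=> //.
by move=> p Jp; apply: JM.
Qed.

(** In the second case of the dichotomy one projects along [V = (v, 0)].  The induction
    hypothesis lifts the image of [e] to a zero [x'] of the eliminated ideal, and
    the extension theorem yields a zero [x' + t V] of [J'].  If [t] were not in the
    maximal ideal, dividing by [t] would give a zero of [r] congruent to [v], where
    [r] is a unit. *)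
Lemma local_lift (n : nat) (J : {mpoly F[n.+1]} -> Prop) :
    ideal J -> homog_closed J ->
    (forall p, J p -> p \is a mpolyOver _ O -> vmax O p.@[affine_point (fun=> 0)]) ->
  exists x : 'I_n -> F, (forall i, vmax O (x i)) /\ forall p, J p -> p.@[affine_point x] = 0.
Proof.
elim: n J => [|n IHn] J Jid Jh Je; have [//|] := local_lift_step Jid Jh Je.
  by case=> J' [d [r [v []]]] [].
case=> J' [d [r [v [i0 [[J'id J'h JJ' J'e] [J'r rd rO rv [vO vi0]]]]]]].
have [vi00 vi0O] := vmaxPn _ _ vi0.
pose V := insert0 ord_max v; pose k := lift ord_max i0.
have Vlift i : V (lift ord_max i) = v i by rewrite /V /insert0 liftK.
have Vmax : V ord_max = 0 by rewrite /V /insert0 unlift_none.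
have VO i : V i \in O.
  by have [j ->|->] := unliftP ord_max i; rewrite ?Vlift ?Vmax ?rpred0.
have Vk : V k != 0 by rewrite Vlift.
(* The projection along [V] keeps the last coordinate, which is the nonzero one of [e]. *)
have kmax : lift k ord_max = ord_max.
  have kv : k = i0 :> nat by rewrite /= /bump leqNgt ltn_ord.
  by apply: val_inj; rewrite -[LHS]/(bump k n) /bump kv -ltnS ltn_ord.
set r2 := subst _ r in J'r.
have r2E w : r2.@[w] = r.@[fun i => w (lift ord_max i)].
  by rewrite meval_subst; apply: meval_eq => i; rewrite mevalXU.
have r2d : r2 \is d.-homog by apply: subst_homog => // i; apply: mpolyX_homog.
have [x' [x'm J''x']] : exists x' : 'I_n -> F, (forall i, vmax O (x' i)) /\
    forall q, J' (subst (slice k V) q) -> q.@[affine_point x'] = 0.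
  apply: IHn; first exact (ideal_preim (subst (slice k V)) J'id).
    move=> d' p J'p; rewrite -pihomog_subst; first exact: J'h.
    exact: slice_homog.
  move=> q J'q qO.
  have -> : q.@[affine_point (fun=> 0)] = (subst (slice k V) q).@[affine_point (fun=> 0)].
    rewrite meval_subst; apply: meval_eq => i.
    rewrite /slice mevalB mevalZ !mevalXU affine_point_lift mulr0 subr0.
    have [->|im] := eqVneq i ord_max; first by rewrite kmax !affine_point_max.
    have [j ->|ie] := unliftP ord_max i; last by rewrite ie eqxx in im.
    rewrite affine_point_lift /affine_point; case: unliftP => // ke.
    have /eqP := etrans ke (esym kmax).
    by rewrite (inj_eq (@lift_inj _ k)) eq_sym (negPf (neq_lift _ _)).
  apply: J'e => //; apply: subst_over => // i.
  rewrite /slice rpredB ?mpolyOverX ?mpolyOverZ ?mpolyOverX //.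
  by rewrite rpredM // Vlift.
have [||t tP] := slice_elimination Vk J'id J'r _ _ J''x' (d := d).
- by have /dhomogP r2h := r2d; move=> m /r2h ->.
- rewrite pihomog_dE // r2E; have [+ _] := vmaxPn _ _ rv.
  by congr (_ != 0); apply: meval_eq => i; rewrite Vlift.
pose W i := insert0 k (affine_point x') i + V i * t.
pose x i := W (lift ord_max i).
have WE : W =1 affine_point x.
  move=> i; have [j ->|->] := unliftP ord_max i; first by rewrite affine_point_lift.
  by rewrite affine_point_max /W Vmax mul0r addr0 -{1}kmax /insert0 liftK affine_point_max.
pose y i := insert0 k (affine_point x') (lift ord_max i).
have xE i : x i = y i + v i * t by rewrite /x /W Vlift.
have ym i : vmax O (y i).
  rewrite /y /insert0; case: unliftP => [j ej|_]; last exact: vmax0.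
  rewrite /affine_point; case: unliftP => [j' _|ej']; first exact: x'm.
  by move: ej; rewrite ej' kmax => /eqP; rewrite eq_sym (negPf (neq_lift _ _)).
(* If [t] is not in the maximal ideal, [x / t] is a zero of [r] congruent to [v]. *)
have tm : vmax O t.
  apply: contraT => /vmaxPn[t0 tO]; case/negP: rv.
  have yO i : y i \in O by apply: vmax_int.
  have rx0 : r.@[fun i => t^-1 * x i] = 0.
    by rewrite (meval_homog _ _ rd) -[r.@[x]]r2E tP // mulr0.
  rewrite -[r.@[v]]subr0 -rx0; apply: vmax_meval => // i.
    by rewrite xE mulrDr mulrCA mulVf // mulr1 rpredD // rpredM.
  rewrite xE mulrDr mulrCA mulVf // mulr1 opprD addrCA subrr addr0.
  by apply: vmaxN; apply: vmaxMl.
exists x; split=> [i|p Jp].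
  by rewrite xE; apply: vmaxD => //; apply: vmaxMl.
by rewrite -(tP p (JJ' p Jp)); apply: meval_eq => i; rewrite -WE.
Qed.

End LocalLift.

(** A linear change of coordinates [h], with inverse [g], moves [c] to [(0, ..., 0, 1)];
    it is defined over [O] as [c_j] is a unit. *)
Lemma lift_point (F : closedFieldType) (O : subringClosed F) (n : nat)
    (J : {mpoly F[n.+1]} -> Prop) (c : 'I_n.+1 -> F) (j : 'I_n.+1) :
    valuation_ring O -> ideal J -> homog_closed J ->
    (forall i, c i \in O) -> ~~ vmax O (c j) ->
    (forall p, J p -> p \is a mpolyOver _ O -> vmax O p.@[c]) ->
  exists x, (forall i, vmax O (x i - c i)) /\ forall p, J p -> p.@[x] = 0.
Proof.
move=> Ov Jid Jh cO cjm Jc; have [cj0 cjO] := vmaxPn _ _ cjm.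
pose h (i : 'I_n.+1) : {mpoly F[n.+1]} :=
  if unlift ord_max i is Some i' then
    'X_(lift j i') - (c (lift j i') / c j) *: 'X_j else (c j)^-1 *: 'X_j.
pose g (i : 'I_n.+1) : {mpoly F[n.+1]} :=
  if unlift j i is Some i' then
    'X_(lift ord_max i') + c (lift j i') *: 'X_ord_max else c j *: 'X_ord_max.
have hmax : h ord_max = (c j)^-1 *: 'X_j by rewrite /h unlift_none.
have hlift i : h (lift ord_max i) = 'X_(lift j i) - (c (lift j i) / c j) *: 'X_j.
  by rewrite /h liftK.
have hgK q : subst h (subst g q) = q.
  rewrite subst_comp -[RHS]subst_id; apply: eq_subst => i; rewrite /g.
  have scale a p : subst h (a *: p) = a *: subst h p.
    by rewrite -!mul_mpolyC rmorphM /= substC.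
  case: unliftP => [i' ->|->].
    by rewrite rmorphD /= scale !substX hmax hlift scalerA subrK.
  by rewrite scale substX hmax scalerA mulfV // scale1r.
have h1 i : h i \is 1.-homog.
  by rewrite /h; case: unliftP => *; rewrite ?rpredB ?rpredZ ?mpolyX_homog.
have [||x [xm Jx]] := local_lift Ov (J := fun p => J (subst h p))
  (ideal_preim (subst h) Jid).
- by move=> d p Jp; rewrite -pihomog_subst //; apply: Jh.
- move=> p Jp pO.
  have -> : p.@[affine_point (fun=> 0)] = (subst h p).@[c].
    rewrite meval_subst; apply: meval_eq => i.
    have [i' ->|->] := unliftP ord_max i.
      by rewrite affine_point_lift hlift mevalB mevalZ !mevalXU divfK // subrr.
    by rewrite affine_point_max hmax mevalZ mevalXU mulVf.
  apply: Jc => //; apply: subst_over => // i.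
  rewrite /h; case: unliftP => *; rewrite ?rpredB ?mpolyOverZ ?mpolyOverX //.
  by rewrite rpredM.
exists (fun i => (g i).@[affine_point x]); split=> [i|p Jp].
  rewrite /g; case: unliftP => [i' ->|->]; last first.
    by rewrite mevalZ mevalXU affine_point_max mulr1 subrr vmax0.
  by rewrite mevalD mevalZ !mevalXU affine_point_max affine_point_lift mulr1 addrK.
by rewrite -meval_subst; apply: Jx; rewrite hgK.
Qed.

(** * Points over the residue field *)

Section ResidueField.
Variables (F : closedFieldType) (O : subringClosed F).

Definition valring : Type := {x : F | x \in O}.
HB.instance Definition _ := [isSub of valring for @sval _ _].
HB.instance Definition _ := [Choice of valring by <:].
HB.instance Definition _ := [SubChoice_isSubComNzRing of valring by <:].

Definition valring_max (a : valring) : bool := vmax O (val a).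

Hypothesis Ov : valuation_ring O.

Lemma valring_max_ideal : idealr_closed valring_max.
Proof.
split; rewrite /in_mem /= /valring_max.
- by rewrite rmorph0 vmax0.
- by rewrite rmorph1 vmax1.
move=> a u v um vm.
suff : vmax O (val a * val u + val v) by rewrite -rmorphM -rmorphD.
by apply: vmaxD => //; apply: vmaxMl; rewrite ?(valP a).
Qed.

End ResidueField.

(** The residue field is presented by two ring morphisms out of a copy [R] of [O], to
    [F] and onto [K].  It is algebraically closed since roots of monic polynomials over
    [O] are in [O]. *)
Lemma residue_field_exists (F : closedFieldType) (O : subringClosed F) :
  valuation_ring O ->
  exists (R : comNzRingType) (iota : {rmorphism R -> F}) (K : closedFieldType)
    (rho : {rmorphism R -> K}),
  [/\ forall x, x \in O <-> exists a, iota a = x,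
    forall y, exists a, rho a = y &
    forall a, rho a = 0 <-> vmax O (iota a)].
Proof.
move=> Ov; pose R : comNzRingType := valring O.
pose I : idealr R := HB.pack (@valring_max F O)
  (isIdealr.Build R (@valring_max F O) (valring_max_ideal Ov)).
pose Q : comNzRingType := {ideal_quot I}.
pose rho : {rmorphism R -> Q} := (\pi_Q)%qT.
have rhoS (y : Q) : exists a, rho a = y by exists (repr y); apply: reprK.
have rho0 a : rho a = 0 <-> vmax O (val a).
  rewrite -[0](rmorph0 rho); split=> [/eqP|am].
    by rewrite -Quotient.idealrBE subr0.
  by apply/eqP; rewrite -Quotient.idealrBE subr0.
have inv_ex (y : Q) : exists z, (y != 0 -> z * y = 1) /\ (y = 0 -> z = 0).
  have [->|y0] := eqVneq y 0; first by exists 0; split=> //; rewrite ?eqxx.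
  have [a ea] := rhoS y.
  have : ~~ vmax O (val a) by apply/negP => /rho0; rewrite ea => /eqP; rewrite (negPf y0).
  case/vmaxPn => a0 aO; exists (rho (exist (fun z => z \in O) _ aO)).
  split=> [_|/eqP]; last by rewrite (negPf y0).
  rewrite -ea -rmorphM -[RHS](rmorph1 rho); congr (rho _).
  by apply: val_inj; rewrite rmorphM rmorph1 /= mulVf.
have [inv invP] := choice inv_ex.
pose Kf : fieldType := HB.pack Q (GRing.ComNzRing_isField.Build Q
  (fun x => (invP x).1) ((invP 0).2 erefl)).
have Kcl : GRing.closed_field_axiom Kf.
  move=> n c n0.
  have [a ac] := choice rhoS.
  pose p : {poly F} := 'X^n - \poly_(i < n) val (a (c i)).
  have szp : (size (\poly_(i < n) val (a (c i))) < size ('X^n : {poly F}))%N.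
    by rewrite size_polyXn ltnS size_poly.
  have pm : p \is monic.
    by rewrite monicE lead_coefDl ?size_polyN // lead_coefXn.
  have [t pt] : exists t, root p t.
    by apply/closed_rootP; rewrite size_polyDl ?size_polyN // size_polyXn eqSS -lt0n.
  have tO : t \in O.
    apply: (int_root Ov pm) pt => i; rewrite coefB coefXn coef_poly rpredB //.
      by case: eqP; rewrite ?rpred0 ?rpred1.
    by case: ifP => _; rewrite ?rpred0 // (valP (a _)).
  exists (rho (exist (fun z => z \in O) t tO)).
  have et : (exist (fun z => z \in O) t tO : R) ^+ n =
      \sum_(i < n) a (c i) * (exist (fun z => z \in O) t tO : R) ^+ i.
    have e : t ^+ n = \sum_(i < n) val (a (c i)) * t ^+ i.
      move/rootP: pt; rewrite hornerD hornerN hornerXn horner_poly => /eqP.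
      by rewrite subr_eq0 => /eqP.
    apply: val_inj; rewrite rmorphXn rmorph_sum; etransitivity; first exact: e.
    by apply: eq_bigr => i _; rewrite rmorphM rmorphXn.
  have := congr1 rho et; rewrite rmorphXn rmorph_sum /= => e.
  etransitivity; first exact: e.
  by apply: eq_bigr => i _; rewrite rmorphM rmorphXn /= ac.
pose Kcc := Field_isAlgClosed.Build Kf Kcl.
pose K : closedFieldType := HB.pack Q Kf Kcc.
exists R, (val : {rmorphism R -> F}), K, (rho : {rmorphism R -> K}).
split=> // x; split=> [xO|[a <-]]; last exact: valP.
by exists (exist (fun z => z \in O) x xO).
Qed.

Lemma ideal_sum (A : comNzRingType) (J : A -> Prop) (I : Type) (r : seq I) (P : pred I) G :
  ideal J -> (forall i, P i -> J (G i)) -> J (\sum_(i <- r | P i) G i).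
Proof. by case=> J0 JD _ JG; apply: (big_ind J). Qed.

(** The algebra behind Rabinowitsch's trick: substitute [1 / f] for [X] and clear
    denominators.  The functional [phi N] does this for polynomials of degree at most
    [N], and telescopes to [0] on multiples of [1 - f X]. *)
Lemma one_sub_mulX (R : comNzRingType) (J : R -> Prop) (f : R) (A B : {poly R}) :
    ideal J -> (forall i, J B`_i) -> 1 = A * (1 - f%:P * 'X) + B ->
  exists N, J (f ^+ N).
Proof.
move=> Jid JB e; have [J0 JD JM] := Jid.
pose phi N (P : {poly R}) := \sum_(i < N.+1) P`_i * f ^+ (N - i).
have phiA : phi (size A).+1 (A * (1 - f%:P * 'X)) = 0.
  set N := size A; have AE i : (A * (1 - f%:P * 'X))`_i.+1 = A`_i.+1 - A`_i * f.
    by rewrite mulrBr mulr1 mulrA coefB coefMX coefMC.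
  have A0 : (A * (1 - f%:P * 'X))`_0 = A`_0.
    by rewrite mulrBr mulr1 mulrA coefB coefMX subr0.
  rewrite /phi big_ord_recl subn0 A0.
  rewrite (eq_bigr (fun i : 'I_N.+1 => A`_i.+1 * f ^+ (N - i) -
      A`_i * f ^+ (N.+1 - i))); last first.
    move=> i _; rewrite lift0 AE subSS mulrBl -mulrA -exprS subSn //.
    by rewrite -ltnS.
  have E1 : \sum_(i < N.+2) A`_i * f ^+ (N.+1 - i) =
      \sum_(i < N.+1) A`_i * f ^+ (N.+1 - i).
    by rewrite big_ord_recr /= [A`_N.+1]nth_default ?leqnSn // mul0r addr0.
  rewrite big_ord_recl subn0 in E1.
  by rewrite sumrB addrA; apply/eqP; rewrite subr_eq0; apply/eqP.
exists (size A).+1.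
have <- : phi (size A).+1 1 = f ^+ (size A).+1.
  rewrite /phi big_ord_recl subn0 coef1 mul1r big1 ?addr0 // => i _.
  by rewrite coef1 mul0r.
rewrite e; have -> : phi (size A).+1 (A * (1 - f%:P * 'X) + B) =
    phi (size A).+1 (A * (1 - f%:P * 'X)) + phi (size A).+1 B.
  by rewrite /phi -big_split; apply: eq_bigr => i _; rewrite coefD mulrDl.
rewrite phiA add0r; apply: ideal_sum => // i _.
by rewrite mulrC; apply: JM.
Qed.

(** Rabinowitsch's trick: a zero of [J] and [1 - f X], with [X] one more variable. *)
Lemma nullstellensatz_away (K : closedFieldType) (n : nat)
    (J : {mpoly K[n]} -> Prop) (f : {mpoly K[n]}) :
    ideal J -> (forall N, ~ J (f ^+ N)) ->
  exists2 x, f.@[x] != 0 & forall p, J p -> p.@[x] = 0.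
Proof.
move=> Jid Jf; have [J0 JD JM] := Jid.
pose e : 'I_n.+1 -> K := affine_point (fun=> 0).
have eN0 : e ord_max != 0 by rewrite /e affine_point_max oner_neq0.
pose s : {rmorphism {mpoly K[n.+1]} -> {poly {mpoly K[n]}}} := along ord_max e.
pose w : {rmorphism {mpoly K[n]} -> {mpoly K[n.+1]}} := subst (fun i => 'X_(lift ord_max i)).
have sX : s 'X_ord_max = 'X.
  rewrite -[LHS]/(line _ _ _ _) lineX /insert0 unlift_none /e affine_point_max.
  by rewrite polyC0 add0r rmorph1 mul1r.
have sw q : s (w q) = q%:P.
  apply: (mpoly_rmorph_ext (f := s \o w) (g := polyC)) => [c|i] /=.
    by rewrite substC -[LHS]/(line _ _ _ _) lineC.
  rewrite substX -[LHS]/(line _ _ _ _) lineX /insert0 liftK /e affine_point_lift.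
  by rewrite rmorph0 mul0r addr0.
have wE q x : (w q).@[x] = q.@[fun i => x (lift ord_max i)].
  by rewrite meval_subst; apply: meval_eq => i; rewrite mevalXU.
pose J' P := exists A B : {poly {mpoly K[n]}},
  s P = A * (1 - f%:P * 'X) + B /\ forall i, J B`_i.
have J'id : ideal J'.
  split=> [|p q [A [B [eA JB]]] [A' [B' [eA' JB']]]|p q [A [B [eA JB]]]].
  - by exists 0, 0; rewrite rmorph0 mul0r addr0; split=> // i; rewrite coef0.
  - exists (A + A'), (B + B'); rewrite rmorphD eA eA' mulrDl addrACA; split=> // i.
    by rewrite coefD; apply: JD.
  exists (s p * A), (s p * B); rewrite rmorphM eA mulrDr mulrA; split=> // i.
  by rewrite coefM; apply: ideal_sum => // j _; apply: JM.
have J'1 : ~ J' 1.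
  case=> A [B [e1 JB]]; rewrite rmorph1 in e1.
  by have [N /Jf] := one_sub_mulX Jid JB e1.
have [x J'x] := weak_nullstellensatz J'id J'1.
exists (fun i => x (lift ord_max i)) => [|p Jp]; last first.
  rewrite -wE; apply: J'x; exists 0, p%:P; rewrite sw mul0r add0r; split=> // i.
  by rewrite coefC; case: ifP.
have : J' (1 - w f * 'X_ord_max).
  exists 1, 0; rewrite rmorphB rmorph1 rmorphM sw sX mul1r addr0; split=> // i.
  by rewrite coef0.
move/J'x; rewrite mevalB meval1 mevalM wE mevalXU => /eqP.
by apply: contraTneq => ->; rewrite mul0r subr0 oner_neq0.
Qed.

Lemma map_mpoly_lift (n : nat) (R S : comNzRingType) (g : {rmorphism R -> S})
    (p : {mpoly S[n]}) :
  (forall m, exists a, g a = p@_m) -> exists q, map_mpoly g q = p.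
Proof.
move=> /choice[a ga]; exists (\sum_(m <- msupp p) a m *: 'X_[m]).
rewrite raddf_sum [RHS]mpolyE; apply: eq_bigr => m _ /=.
by rewrite map_mpolyZ map_mpolyX ga.
Qed.

Lemma meval_map_mpoly (n : nat) (R S : comNzRingType) (g : {rmorphism R -> S})
  (q : {mpoly R[n]}) a : (map_mpoly g q).@[g \o a] = g q.@[a].
Proof.
pose f1 : {rmorphism {mpoly R[n]} -> S} := meval (g \o a) \o map_mpoly g.
pose f2 : {rmorphism {mpoly R[n]} -> S} := g \o meval a.
apply: (mpoly_rmorph_ext (f := f1) (g := f2)) => [c|i].
  by rewrite /f1 /f2 /= map_mpolyC !mevalC.
by rewrite /f1 /f2 /= map_mpolyX !mevalXU.
Qed.

(** The Nullstellensatz is applied to the ideal of the reductions of the elements of [J]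
    over [O]; a power of the reduction of [f] in this ideal is what the last hypothesis
    excludes. *)
Lemma residue_point (F : closedFieldType) (O : subringClosed F) (n : nat)
    (J : {mpoly F[n]} -> Prop) (f : {mpoly F[n]}) :
    valuation_ring O -> ideal J -> f \is a mpolyOver n O ->
    (forall N p, J p -> p \is a mpolyOver n O ->
      ~ (forall m, vmax O (p - f ^+ N)@_m)) ->
  exists c, [/\ forall i, c i \in O, ~~ vmax O f.@[c] &
    forall p, J p -> p \is a mpolyOver n O -> vmax O p.@[c]].
Proof.
move=> Ov Jid fO Jf; have [J0 JD JM] := Jid.
have [R [iota [K [rho [iotaO rhoS rho0]]]]] := residue_field_exists Ov.
have liftO p : p \is a mpolyOver n O -> exists q, map_mpoly iota q = p.
  by move=> /mpolyOverP pO; apply: map_mpoly_lift => m; apply/iotaO.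
have [fR efR] := liftO f fO.
pose JK P := exists2 q : {mpoly R[n]}, P = map_mpoly rho q & J (map_mpoly iota q).
have JKid : ideal JK.
  split=> [|_ _ [p -> Jp] [q -> Jq]|P _ [q -> Jq]].
  - by exists 0; rewrite rmorph0.
  - by exists (p + q); rewrite rmorphD //; apply: JD.
  have [p <-] := map_mpoly_lift (p := P) (fun m => rhoS _).
  by exists (p * q); rewrite rmorphM //; apply: JM.
have [|y fy JKy] := nullstellensatz_away (f := map_mpoly rho fR) JKid.
  move=> N [q eq Jq]; apply: (Jf N (map_mpoly iota q)) => // [|m].
    by apply/mpolyOverP => m; rewrite mcoeff_map_mpoly; apply/iotaO; exists q@_m.
  rewrite -efR -rmorphXn -rmorphB mcoeff_map_mpoly; apply/rho0.
  by rewrite -mcoeff_map_mpoly rmorphB rmorphXn /= eq subrr mcoeff0.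
have [a ay] := choice rhoS.
have ey : y = rho \o (a \o y) by apply/funext => i /=; rewrite ay.
exists (iota \o (a \o y)); split=> [i||p Jp pO].
- by apply/iotaO; exists (a (y i)).
- rewrite -efR meval_map_mpoly; apply: contra fy => /rho0.
  by rewrite {2}ey meval_map_mpoly => ->.
have [q eq] := liftO p pO; rewrite -eq meval_map_mpoly; apply/rho0.
by rewrite -meval_map_mpoly -ey; apply: JKy; exists q; rewrite ?eq.
Qed.

(** * Multiplicative subgroups with the root lifting property *)

(** Here [U] stands for the fibre of [f] over [1].  Applying [f] to a linear relation between
    elements of [U] makes [1] a root of the polynomial with the same coefficients;
    [Uroot] says that this root lifts to [U]. *)
Section RootLiftingSubgroup.
Variables (F : fieldType) (U : F -> Prop).
Hypothesis U1 : U 1.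
Hypothesis UM : forall x y, U x -> U y -> U (x * y).
Hypothesis UV : forall x, U x -> U x^-1.
Hypothesis U0 : ~ U 0.
Hypothesis Uroot : forall k (c u : nat -> F), (forall i, U (u i)) ->
  \sum_(i < k) c i * u i = 0 -> exists2 t, U t & \sum_(i < k) c i * t ^+ i = 0.

Let UN0 x : U x -> x != 0.
Proof. by move=> Ux; apply: contra_not_neq U0 => <-. Qed.

(** The relation between [a, - l a, b, - l b] expressing that [l] is the quotient of [a + b] by
    [a u + b v] is satisfied by the powers of some [t] in [U], and the resulting
    polynomial factors as [(1 - l t) (a + b t^2)].  In terms of classes modulo [U], the
    hypersum of two classes that are not opposite is a single class. *)
Lemma sum_class_unique a b u v :
    U u -> U v -> (forall w, U w -> a <> - (w * b)) ->
  exists2 w, U w & a * u + b * v = w * (a + b).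
Proof.
move=> Uu Uv nab; pose l := (a + b) / (a * u + b * v).
have c'0 : a * u + b * v != 0.
  apply/eqP => /eqP; rewrite addr_eq0 => /eqP e; apply: (nab (v / u)).
    by apply/UM/UV.
  by apply: (mulIf (UN0 Uu)); rewrite e mulNr mulrAC divfK ?UN0 // mulrC.
pose c i := nth 0 [:: a; - (l * a); b; - (l * b)] i.
pose u' i := nth 1 [:: 1; u; 1; v] i.
have Uu' i : U (u' i) by case: i => [|[|[|[|i]]]] //=; rewrite /u' /= ?nth_nil.
have [|t Ut] := Uroot (k := 4) (c := c) Uu'.
  rewrite !big_ord_recr big_ord0 /= /c /u' /=.
  have -> : 0 + a * 1 + - (l * a) * u + b * 1 + - (l * b) * v =
    (a + b) - l * (a * u + b * v) by ring.
  by rewrite /l divfK // subrr.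
rewrite !big_ord_recr big_ord0 /= /c /=.
have -> : 0 + a * t ^+ 0 + - (l * a) * t ^+ 1 + b * t ^+ 2 + - (l * b) * t ^+ 3 =
  (1 - l * t) * (a + b * t ^+ 2) by ring.
move/eqP; rewrite mulf_eq0 subr_eq0 addr_eq0 => /orP[/eqP lt|/eqP abt].
  by exists t => //; rewrite -[LHS]mulr1 lt /l; field.
have Ut2 : U (t ^+ 2) by rewrite expr2; apply: (UM).
by case: (nab _ Ut2); rewrite [LHS]abt mulrC.
Qed.

Let packO (P : F -> Prop) : P 1 -> (forall x y, P x -> P y -> P (x - y)) ->
    (forall x y, P x -> P y -> P (x * y)) ->
  exists O : subringClosed F, forall x, (x \in O) = `[< P x >].
Proof.
move=> P1 PB PM.
have Pc : subring_closed (fun x => `[< P x >]).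
  split=> [|x y|x y]; rewrite !unfold_in; first exact/asboolP.
    by move=> /asboolP Px /asboolP Py; apply/asboolP/PB.
  by move=> /asboolP Px /asboolP Py; apply/asboolP/PM.
pose O : subringClosed F := HB.pack (fun x => `[< P x >])
  (GRing.isSubringClosed.Build F (fun x => `[< P x >]) Pc).
by exists O.
Qed.

Let sum_class x u w : U u -> U w -> (forall z, U z -> x <> - z) ->
  exists2 z, U z & u + x * w = z * (1 + x).
Proof.
move=> Uu Uw nx; have [z Uz|z Uz] := @sum_class_unique 1 x u w Uu Uw; last first.
  by rewrite mul1r => ->; exists z.
move=> e; apply: (nx z^-1); first exact: UV.
by apply: (mulfI (UN0 Uz)); rewrite mulrN mulfV ?UN0 // e opprK.
Qed.

(** When no difference of elements of [U] is in [U], [W = U - 1] is an additive group,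
    and the ring is the set of multipliers of [W].  It is a valuation ring because
    [1 + z w = (1 - z) + z (1 + w)] has the class of [1] unless [1 - z] is in
    [- U z], in which case [z / (z - 1)] is in [U].  If this happens for [z] and
    [z^-1], then [1 - z] and [- z] are in [U], with difference [1]. *)
Lemma one_units_valuation : (forall u v, U u -> U v -> ~ U (u - v)) ->
  exists O : subringClosed F, valuation_ring O /\ forall x, U x <-> vmax O (x - 1).
Proof.
move=> UU; pose W x := U (1 + x).
have WnU x : W x -> forall w, U w -> x <> w.
  by move=> Wx w Uw xw; apply: (UU _ _ Wx U1); rewrite addrC addKr xw.
have WnNU x : W x -> forall w, U w -> x <> - w.
  by move=> Wx w Uw xw; apply: (UU _ _ U1 Uw); rewrite -xw.
have W0 : W 0 by rewrite /W addr0.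
have WD x y : W x -> W y -> W (x + y).
  move=> Wx Wy; have [z Uz] := sum_class Wx U1 (WnNU _ Wy).
  by rewrite mulr1 -addrA /W => ->; apply: (UM).
have WN x : W x -> W (- x).
  move=> Wx; have [|z Uz] := @sum_class (- x) (1 + x) 1 Wx U1.
    by move=> z Uz /oppr_inj; apply: WnU.
  rewrite mulr1 addrK /W => e.
  have -> : 1 - x = z^-1 by apply: (mulfI (UN0 Uz)); rewrite -e mulfV ?UN0.
  exact: UV.
have WM x y : W x -> W y -> W (x * y).
  move=> Wx Wy; have -> : x * y = ((1 + x) * (1 + y) - 1) - x - y by ring.
  apply: (WD); last exact: WN.
  by apply: (WD); last exact: WN; rewrite /W addrC subrK; apply: (UM).
pose R z := forall w, W w -> W (z * w).
have [|||O OE] := @packO R.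
- by move=> w Ww; rewrite mul1r.
- by move=> x y Rx Ry w Ww; rewrite mulrBl; apply: (WD); [apply: Rx|apply/WN/Ry].
- by move=> x y Rx Ry w Ww; rewrite -mulrA; apply/Rx/Ry.
(* Unless [1 - z] is in [- U z], the class of [(1 - z) 1 + z (1 + w)] is that of
   [(1 - z) + z = 1]. *)
have R_or z : R z \/ exists2 u, U u & z = u * (z - 1).
  have [[u Uu zu]|nu] := pselect (exists2 u, U u & z = u * (z - 1)).
    by right; exists u.
  left=> w Ww; have [|k Uk] := @sum_class_unique (1 - z) z 1 (1 + w) U1 Ww.
    move=> u Uu e; apply: nu; exists u^-1; first exact: UV.
    by rewrite -opprB e opprK mulKf ?UN0.
  by rewrite /W subrK !mulr1 mulrDr mulr1 addrA subrK => ->.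
have inv_or z : z != 0 -> R z^-1 \/ U (1 - z).
  move=> z0; have [|[v Uv e]] := R_or z^-1; first by left.
  right; have -> : 1 - z = v^-1; last exact: UV.
  have vz : v * (1 - z) = 1.
    apply: (mulIf (invr_neq0 z0)); rewrite mul1r {2}e -mulrA; congr (_ * _).
    by rewrite mulrBl mul1r mulfV.
  by apply: (mulfI (UN0 Uv)); rewrite mulfV ?UN0.
exists O; have Ov : valuation_ring O.
  move=> z; rewrite !OE => /asboolPn nRz; apply/asboolP.
  have z0 : z != 0.
    by apply: contra_notN nRz => /eqP-> w _; rewrite mul0r.
  have [//|[u Uu zu]] := R_or z; have [//|U1z] := inv_or z z0.
  case: (UU _ _ U1z (UM Uu U1z)).
  have -> : 1 - z - u * (1 - z) = 1 - z + u * (z - 1) by ring.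
  by rewrite -zu subrK.
split=> // x.
suff WE y : W y <-> vmax O y by rewrite -WE /W addrC subrK.
rewrite /vmax OE; split=> [Wy|/orP[/eqP->//|/asboolPn nRy]].
  have [//|y0] := eqVneq y 0; apply/asboolPn => /(_ _ Wy).
  by rewrite mulVf // => W1; apply: (UU _ _ W1 U1); rewrite addrK.
have y0 : y != 0.
  by apply: contra_notN nRy => /eqP-> w _; rewrite invr0 mul0r.
by have [//|U1y] := inv_or y y0; rewrite -[y]opprK; apply: (WN).
Qed.

(** When some difference of elements of [U] is in [U], the candidate maximal ideal [M]
    consists of the [y] outside [U] with [1 + y] in [U].  Every nonzero element is in
    [U], in [M] or the inverse of an element of [M], exclusively, and [U] and [M]
    together form the valuation ring. *)
Lemma units_valuation : (exists u v, [/\ U u, U v & U (u - v)]) ->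
  exists O : subringClosed F, valuation_ring O /\
    forall x, U x <-> x \in O /\ ~~ vmax O x.
Proof.
case=> [u0 [v0 [Uu0 Uv0 Uuv]]].
(* The relation [v0 - u0 + (u0 - v0) = 0] yields [t] in [U] with [t^2 - t + 1 = 0], so
   [t^3 = -1]. *)
have UN1 : U (-1).
  pose c i : F := nth 0 [:: 1; -1; 1] i.
  pose u' i := nth 1 [:: v0; u0; u0 - v0] i.
  have Uu' i : U (u' i) by case: i => [|[|[|i]]] //=; rewrite /u' /= ?nth_nil.
  have [|t Ut] := Uroot (k := 3) (c := c) Uu'.
    by rewrite !big_ord_recr big_ord0 /= /c /u' /=; ring.
  rewrite !big_ord_recr big_ord0 /= /c /= => e.
  have -> : -1 = t ^+ 3.
    apply/esym/eqP; rewrite -subr_eq0 opprK.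
    have -> : t ^+ 3 + 1 =
      (t + 1) * (0 + 1 * t ^+ 0 + -1 * t ^+ 1 + 1 * t ^+ 2) by ring.
    by rewrite e mulr0.
  by rewrite !exprS expr0 mulr1; do 2!apply: (UM) => //.
have UN x : U x -> U (- x) by move=> Ux; rewrite -mulN1r; apply: (UM).
have [a [b [Ua Ub ab]]] : exists a b, [/\ U a, U b & a + b = 1].
  exists (v0 / u0), ((u0 - v0) / u0).
  split; [by apply/UM/UV|by apply/UM/UV|].
  by rewrite -mulrDl addrC subrK mulfV ?UN0.
have sum x u w : ~ U x -> U u -> U w -> exists2 z, U z & u + x * w = z * (1 + x).
  move=> nUx Uu Uw; apply: sum_class => // z Uz e; apply: nUx.
  by rewrite e; apply: (UN).
have div x y z : U z -> x = z * y -> y = z^-1 * x.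
  by move=> Uz ->; rewrite mulKf ?UN0.
(* With [1 = a + b], the sum [1 + y = a + (b + y)] has the class of [1 + (1 + y)] if [y]
   and [1 + y] are outside [U], and so has [y = -1 + (1 + y)]. *)
have alt y : ~ U y -> U (1 + y) \/ exists2 z, U z & 1 + y = z * y.
  move=> nUy; have [z Uz bz] := sum y b 1 nUy Ub U1; rewrite mulr1 in bz.
  have [Us|nUs] := pselect (U (1 + y)); [by left|right].
  have [z1 Uz1 e1] := sum _ a z nUs Ua Uz.
  have [z2 Uz2 e2] := sum _ (-1) 1 nUs UN1 U1.
  have sE : 1 + y = z1 * (1 + (1 + y)) by rewrite -e1 [_ * z]mulrC -bz addrA ab.
  have yE : y = z2 * (1 + (1 + y)) by rewrite -e2 mulr1 addKr.
  exists (z1 * z2^-1); first by apply/UM/UV.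
  by rewrite -mulrA -(div _ _ _ Uz2 yE).
pose M y := ~ U y /\ U (1 + y).
have M0 : M 0 by rewrite /M addr0.
have excl y : y != 0 -> M y -> ~ M y^-1.
  move=> y0 [nUy U1y] [_ U1y']; apply: nUy.
  have -> : y = (1 + y) / (1 + y^-1).
    by apply: (mulIf (UN0 U1y')); rewrite divfK ?UN0 // mulrDr mulr1 mulfV // addrC.
  by apply/UM/UV.
have tri y : y != 0 -> [\/ U y, M y | M y^-1].
  move=> y0; have [Uy|nUy] := pselect (U y); first by constructor 1.
  have [U1y|[z Uz e]] := alt y nUy; first by constructor 2.
  constructor 3; split=> [/UV|]; first by rewrite invrK.
  have -> : 1 + y^-1 = z; last by [].
  by apply: (mulIf y0); rewrite -e mulrDl mul1r mulVf // addrC.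
have MU u y : U u -> M y -> M (u * y).
  move=> Uu [nUy U1y]; split.
    by move=> Uuy; apply: nUy; rewrite -(mulKf (UN0 Uu) y); apply: (UM) => //; apply: (UV).
  by have [z Uz] := sum y 1 u nUy U1 Uu; rewrite [_ * u]mulrC => ->; apply: (UM).
have UMsum u y : U u -> M y -> U (u + y).
  move=> Uu [nUy U1y]; have [z Uz] := sum y u 1 nUy Uu U1.
  by rewrite mulr1 => ->; apply: (UM).
have MN y : M y -> M (- y) by move=> My; rewrite -mulN1r; apply: (MU).
have MM x y : M x -> M y -> M (x * y).
  move=> Mx My; have [->|x0] := eqVneq x 0; first by rewrite mul0r.
  have [->|y0] := eqVneq y 0; first by rewrite mulr0.
  have [Uxy|//|Mxy] := tri (x * y) (mulf_neq0 x0 y0).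
    case: (excl y y0 My); have -> : y^-1 = (x * y)^-1 * x.
      by rewrite invfM mulrAC mulVf // mul1r.
    by apply: (MU) => //; apply: (UV).
  case: (Mxy) => nU _; case: nU.
  have U4 : U (1 + (x * (1 + y))) by have [_] := MU _ _ (proj2 My) Mx; rewrite mulrC.
  have U2 : U (1 + x + (x * y)) by move: U4; rewrite mulrDr mulr1 addrA.
  have U3 : U ((x * y)^-1 * (1 + x + x * y)).
    rewrite mulrDr mulVf ?mulf_neq0 // addrC mulrC; apply: (UMsum) => //.
    by apply: (MU) => //; case: Mx.
  have -> : (x * y)^-1 = (x * y)^-1 * (1 + x + x * y) / (1 + x + x * y).
    by rewrite mulfK ?UN0.
  by apply/UM/UV.
pose R x := U x \/ M x.
have RN x : R x -> R (- x) by case=> [/UN|/MN]; [left|right].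
have RD x y : R x -> R y -> R (x + y).
  have notM z : z != 0 -> M z^-1 -> forall x' y', x' + y' = z ->
      R x' -> R y' -> False.
    move=> z0 Mz x' y' exy.
    have e1 : x' * z^-1 + y' * z^-1 = 1 by rewrite -mulrDl exy mulfV.
    have Mx'y' w : R w -> M (w * z^-1).
      by case=> [Uw|Mw]; [apply: (MU)|apply: (MM)].
    move=> /Mx'y' Mx' /Mx'y' My'.
    have [nU _] := My'; apply: nU.
    have -> : y' * z^-1 = 1 + - (x' * z^-1) by rewrite -e1 addrC addKr.
    by apply: (UMsum) => //; apply: (MN).
  move=> Rx Ry; have [->|z0] := eqVneq (x + y) 0; first by right.
  by have [|?|/(notM _ z0)/(_ x y erefl Rx Ry)//] := tri _ z0; [left|right].
have RM x y : R x -> R y -> R (x * y).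
  case=> [Ux|Mx] [Uy|My]; first by left; apply: (UM).
  - by right; apply: (MU).
  - by right; rewrite mulrC; apply: (MU).
  by right; apply: (MM).
have [|||O OE] := @packO R.
- by left.
- by move=> x y Rx /RN; apply: (RD).
- exact: RM.
exists O; split=> [x|x].
  rewrite !OE => /asboolPn nRx; apply/asboolP.
  have x0 : x != 0 by apply: contra_notN nRx => /eqP->; right.
  by have [Ux|Mx|] := tri x x0; [case: nRx; left|case: nRx; right|right].
rewrite /vmax OE; split=> [Ux|[/asboolP Rx]].
  split; first by apply/asboolP; left.
  by rewrite (negPf (UN0 Ux)) OE negbK; apply/asboolP; left; apply: (UV).
rewrite negb_or OE negbK => /andP[x0 /asboolP Rx'].
case: Rx => // Mx; case: Rx' => [/UV|/(excl x x0 Mx)//].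
by rewrite invrK.
Qed.

End RootLiftingSubgroup.

(** * Hypersums and the fibre over the unit *)

Local Open Scope classical_set_scope.

Section HyperSum.
Variable H : hyperfield.

Lemma setopP (A B : set H) z :
  setop (@hadd H) A B z <-> exists a b, [/\ A a, B b & hadd a b z].
Proof.
split=> [[a Aa [b Bb abz]]|[a [b [Aa Bb abz]]]]; first by exists a, b.
by exists a => //; exists b.
Qed.

Lemma setopA : associative (setop (@hadd H)).
Proof.
move=> A B C; apply/seteqP; split=> z /setopP.
  move=> [a [bc [Aa /setopP[b [c [Bb Cc bcE]]] zE]]].
  have : setop (@hadd H) [set a] (hadd b c) z by apply/setopP; exists a, bc.
  rewrite haddA => /setopP[ab [c' [abE -> z'E]]].
  by apply/setopP; exists ab, c; split=> //; apply/setopP; exists a, b.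
move=> [ab [c [/setopP[a [b [Aa Bb abE]]] Cc zE]]].
have : setop (@hadd H) (hadd a b) [set c] z by apply/setopP; exists ab, c.
rewrite -haddA => /setopP[a' [bc [-> bcE z'E]]].
by apply/setopP; exists a, bc; split=> //; apply/setopP; exists b, c.
Qed.

Lemma setopC : commutative (setop (@hadd H)).
Proof.
move=> A B; apply/seteqP; split=> z /setopP[a [b [Aa Bb zE]]];
  by apply/setopP; exists b, a; split=> //; rewrite haddC.
Qed.

Lemma setop0 : left_id [set hzero] (setop (@hadd H)).
Proof.
move=> A; apply/seteqP; split=> z.
  by move=> /setopP[a [b [-> Ab]]]; rewrite hadd0 => ->.
by move=> Az; apply/setopP; exists hzero, z; rewrite hadd0.
Qed.

HB.instance Definition _ := Monoid.isComLaw.Build (set H) [set hzero]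
  (setop (@hadd H)) setopA setopC setop0.

(** Hypersums become iterated operations of a commutative monoid of sets, so that they
    can be reindexed freely. *)
Lemma hsumE (s : seq H) :
  hsum s = \big[setop (@hadd H)/[set hzero]]_(x <- s) [set x].
Proof. by elim: s => [|x s IHs]; rewrite ?big_nil // big_cons /= IHs. Qed.

End HyperSum.

Lemma field_hsum (F : fieldType) (s : seq F) :
  @hsum (field_hyperfield F) s = [set \sum_(x <- s) x].
Proof.
elim: s => [|x s IHs]; first by rewrite big_nil.
by rewrite big_cons /= IHs /setop !bigcup_set1.
Qed.

Lemma field_hpow (F : fieldType) (x : F) k : @hpow (field_hyperfield F) x k = x ^+ k.
Proof. by elim: k => [|k IHk]; rewrite ?expr0 // exprS -IHk. Qed.

Section RelativelyAlgebraicallyClosed.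
Variables (F : closedFieldType) (H : hyperfield).
Variable f : hyperhom (field_hyperfield F) H.

(** Having [0] in the hypersum of the [f x]: the only feature of the hyperaddition of
    [H] that matters for zero loci. *)
Definition balanced (s : seq F) : Prop :=
  (\big[setop (@hadd H)/[set hzero]]_(x <- s) [set f x]) hzero.

Lemma balanced_sum0 s : \sum_(x <- s) x = 0 -> balanced s.
Proof.
move=> s0; suff : (\big[setop (@hadd H)/[set hzero]]_(x <- s) [set f x])
    (f (\sum_(x <- s) x)).
  by rewrite s0 -[f 0]/(f (@hzero (field_hyperfield F))) hom0.
elim: s {s0} => [|x s IHs]; first by rewrite !big_nil; apply: (hom0 f).
rewrite !big_cons; apply/setopP; exists (f x), (f (\sum_(y <- s) y)); split=> //.
by apply: homD; exists (x + \sum_(y <- s) y).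
Qed.

Hypothesis fR : rel_alg_closed f.

Lemma hpow1 (k : nat) : hpow (hone : H) k = hone.
Proof. by elim: k => //= k IHk; rewrite IHk hmul1. Qed.

(** The polynomial over [F] with coefficients [g m] has the root [1] in [H], which lifts
    to [F].  Exponents are positions in [r], and vanishing terms are left out since
    formal polynomials have nonzero coefficients. *)
Lemma balanced_root (T : eqType) (r : seq T) (g : T -> F) : uniq r ->
    balanced [seq g m | m <- r] ->
  exists2 t : F, f t = hone & \sum_(m <- r) g m * t ^+ index m r = 0.
Proof.
move=> ru; pose D := [fset i in [seq index m r | m <- r & g m != 0]]%fset.
pose G i : F := nth 0 [seq g m | m <- r] i.
have GE m : m \in r -> G (index m r) = g m.
  by move=> mr; rewrite /G (nth_map m) ?index_mem // nth_index.
have D0 (i : D) : G (val i) <> 0.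
  apply/eqP; have := valP i; rewrite !inE => /mapP[m].
  by rewrite mem_filter => /andP[gm mr] ->; rewrite GE.
pose p : hpoly (field_hyperfield F) := [fmap d : D => exist _ (G (val d)) (@D0 d)]%fset.
have bigD (R : Type) (idx : R) (op : Monoid.com_law idx) (h : nat -> R) :
    \big[op/idx]_(d : D) h (val d) = \big[op/idx]_(m <- r | g m != 0) h (index m r).
  rewrite -(big_seq_fsetE _ D xpredT h) /=.
  have -> : \big[op/idx]_(m <- r | g m != 0) h (index m r) =
      \big[op/idx]_(i <- [seq index m r | m <- r & g m != 0]) h i.
    by rewrite big_map big_filter.
  apply: perm_big; apply: uniq_perm; rewrite ?fset_uniq //.
    rewrite map_inj_in_uniq ?filter_uniq // => m m'.
    rewrite !mem_filter => /andP[_ mr] /andP[_ m'r].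
    by move=> /(congr1 (nth m r)); rewrite !nth_index.
  by move=> i; rewrite !inE.
move=> rb; have [t ft pt] : exists2 t : F, f t = hone & hroots p t.
  apply: (proj2 fR p hone); rewrite /hroots /= /heval hsumE big_image /=.
  rewrite (eq_bigr (fun d : D => [set f (G (val d))])); last first.
    by move=> d _; rewrite !ffunE /= hpow1 hmulC hmul1.
  rewrite (bigD _ _ _ (fun i => [set f (G i)])).
  rewrite big_mkcond (eq_big_seq (fun m => [set f (g m)])).
    by move: rb; rewrite /balanced big_map.
  move=> m mr; rewrite GE //; case: eqP => //= ->.
  by rewrite -[0 : F]/(@hzero (field_hyperfield F)) hom0.
exists t => //; move: pt; rewrite /hroots /= /heval field_hsum big_image /=.
rewrite (eq_bigr (fun d : D => G (val d) * t ^+ val d)); last first.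
  by move=> d _; rewrite ffunE /= field_hpow.
rewrite (bigD _ _ _ (fun i => G i * t ^+ i)) => /esym e.
rewrite -[RHS]e [in RHS]big_mkcond; apply: eq_big_seq => m mr.
by rewrite GE //; case: eqP => //= ->; rewrite mul0r.
Qed.

End RelativelyAlgebraicallyClosed.

(** As [f] is multiplicative, membership in the zero locus of a push-forward only depends
    on the terms of [p] at a lift of the point. *)
Lemma hmroots_push (F : closedFieldType) (H : hyperfield)
    (f : hyperhom (field_hyperfield F) H) (n : nat) (p : {mpoly F[n]}) (a : 'I_n -> F) :
  hmroots (hmpush f (hmpoly_of p)) (fun i => f (a i)) <->
  balanced f [seq p@_m * \prod_i a i ^+ m i | m <- msupp p].
Proof.
have fpow x k : hpow (f x) k = f (x ^+ k).
  elim: k => [|k IHk]; first by rewrite expr0; apply: (esym (hom1 f)).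
  by rewrite exprS /= IHk -homM.
have fmon (m : 'X_{1..n}) : hmonom (fun i => f (a i)) m = f (\prod_i a i ^+ m i).
  rewrite /hmonom; elim/big_ind2: _ => [|x x' y y' -> ->|i _]; last exact: fpow.
    exact: (esym (hom1 f)).
  by rewrite -homM.
rewrite /hmroots /= /hmeval hsumE big_image /= /balanced.
set S1 := \big[_/_]_(i in _) _; set S2 := \big[_/_]_(i <- _) _.
suff -> : S1 = S2 by [].
rewrite {}/S1 {}/S2 big_map.
rewrite (eq_bigr (fun d : [fset m in msupp p]%fset =>
  [set f (p@_(val d) * \prod_i a i ^+ (val d) i)])); last first.
  by move=> d _; rewrite !ffunE /= fmon -homM.
rewrite -(big_seq_fsetE _ [fset m in msupp p]%fset xpredT
  (fun m => [set f (p@_m * \prod_i a i ^+ m i)])) /=.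
apply: perm_big; apply: uniq_perm; rewrite ?fset_uniq ?msupp_uniq //.
by move=> m; rewrite !inE.
Qed.

(** The fibre over [1] is a multiplicative subgroup.  A relation with coefficients [c_i]
    between elements of [U] makes the [c_i] balanced, since [f] does not see the factors
    in [U]; hence the root lifting property. *)
Lemma fiber_valuation (F : closedFieldType) (H : hyperfield)
    (f : hyperhom (field_hyperfield F) H) : rel_alg_closed f ->
  exists O : subringClosed F, valuation_ring O /\
    ((forall x : F, f x = hone <-> vmax O (x - 1)) \/
     (forall x : F, f x = hone <-> x \in O /\ ~~ vmax O x)).
Proof.
move=> fR; pose U (x : F) := f x = hone.
have f0 : f (0 : F) = hzero by apply: (hom0 f).
have f1 : f (1 : F) = hone by apply: (hom1 f).
have fM (x y : F) : f (x * y) = hmul (f x) (f y) by apply: (homM f).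
have U0 : ~ U 0 by rewrite /U f0 => /esym; apply: hone_neq0.
have UM x y : U x -> U y -> U (x * y) by rewrite /U fM => -> ->; rewrite hmul1.
have UV x : U x -> U x^-1.
  move=> Ux; have x0 : x != 0 by apply: contra_not_neq U0 => <-.
  by rewrite /U -[LHS]hmul1 -[X in hmul X]Ux -fM mulfV.
have Uroot k (c u : nat -> F) : (forall i, U (u i)) ->
    \sum_(i < k) c i * u i = 0 -> exists2 t, U t & \sum_(i < k) c i * t ^+ i = 0.
  move=> Uu cu0.
  have sum_iota (h : nat -> F) : \sum_(i <- iota 0 k) h i = \sum_(i < k) h i.
    by rewrite -(big_mkord xpredT) /index_iota subn0.
  have : balanced f [seq c i | i <- iota 0 k].
    have : balanced f [seq c i * u i | i <- iota 0 k].
      by apply: balanced_sum0; rewrite big_map sum_iota.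
    rewrite /balanced !big_map (eq_bigr (fun i => [set f (c i)])) // => i _.
    by rewrite fM Uu hmulC hmul1.
  case/(balanced_root fR (iota_uniq 0 k)) => t ft t0; exists t => //.
  rewrite -[RHS]t0 sum_iota; apply: eq_bigr => i _; congr (_ * t ^+ _).
  by rewrite -{2}[val i](nth_iota 0 0 (ltn_ord i)) index_uniq ?iota_uniq ?size_iota.
have [[u [v uv]]|nuv] := pselect (exists u v, [/\ U u, U v & U (u - v)]).
  have [|O [Ov UE]] := units_valuation f1 UM UV U0 Uroot; first by exists u, v.
  by exists O; split=> //; right.
have [|O [Ov UE]] := one_units_valuation f1 UM UV U0 Uroot.
  by move=> u v Uu Uv Uuv; apply: nuv; exists u, v.
by exists O; split=> //; left.
Qed.

Lemma mcoeff_scale (n : nat) (K : comNzRingType) (a : 'I_n -> K) (p : {mpoly K[n]}) m :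
  (subst (fun i => a i *: 'X_i) p)@_m = p@_m * \prod_i a i ^+ m i.
Proof.
have -> : subst (fun i => a i *: 'X_i) p =
    \sum_(k <- msupp p) (p@_k)%:MP * mmap1 (fun i => a i *: 'X_i) k by [].
rewrite [p in RHS](mpolyE p) !raddf_sum mulr_suml; apply: eq_bigr => k _ /=.
have -> : mmap1 (fun i => a i *: 'X_i : {mpoly K[n]}) k = (\prod_i a i ^+ k i) *: 'X_[k].
  rewrite /mmap1 mpolyXE_id -scaler_prod; apply: eq_bigr => i _.
  by rewrite exprZn.
rewrite mul_mpolyC !mcoeffZ mcoeffX; case: eqP => [->|]; rewrite ?mulr1 //.
by rewrite !mulr0 mul0r.
Qed.

(** * Points of the push-forward variety *)

Section FiberLift.
Variables (F : closedFieldType) (H : hyperfield).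
Variable f : hyperhom (field_hyperfield F) H.
Hypothesis fR : rel_alg_closed f.
Variables (n : nat) (I : {mpoly F[n.+1]} -> Prop) (a : 'I_n.+1 -> F).
Hypotheses (Iid : ideal I) (Ih : homog_closed I).
Hypothesis Ia : forall p, I p ->
  balanced f [seq p@_m * \prod_i a i ^+ m i | m <- msupp p].

Let supp_ind (i : 'I_n.+1) : F := (a i != 0)%:R.

(** The polynomials [q] such that [q (x) = p (a x)] for some [p] in [I], the [x_i] with
    [a_i = 0] being set to [0].  For such [i] the coordinate [x_i] is irrelevant to
    [a x]; substituting [0] leaves [q] unconstrained there, which spares a restriction of the
    set of variables. *)
Definition rescaled (q : {mpoly F[n.+1]}) : Prop :=
  exists2 p, I p & subst (fun i => supp_ind i *: 'X_i) q = subst (fun i => a i *: 'X_i) p.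

Let scale_scale (u v : 'I_n.+1 -> F) p :
  subst (fun i => u i *: 'X_i) (subst (fun i => v i *: 'X_i) p) =
  subst (fun i => (v i * u i) *: 'X_i) p.
Proof.
rewrite subst_comp; apply: eq_subst => i.
by rewrite -mul_mpolyC rmorphM /= substC substX mul_mpolyC scalerA.
Qed.

Let scale_homog (u : 'I_n.+1 -> F) i : u i *: 'X_i \is [in F[n.+1], 1.-homog].
Proof. by rewrite rpredZ ?mpolyX_homog. Qed.

Let supp_indK i : a i * supp_ind i = a i.
Proof. by rewrite /supp_ind; case: eqP => [->|]; rewrite ?mul0r ?mulr1. Qed.

Lemma rescaled_ideal : ideal rescaled.
Proof.
have [I0 ID IM] := Iid; split=> [|q q' [p Ip e] [p' Ip' e']|q' q [p Ip e]].
- by exists 0; rewrite ?rmorph0.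
- by exists (p + p'); [apply: ID|rewrite !rmorphD /= e e'].
exists (subst (fun i => (a i)^-1 *: 'X_i) q' * p); first exact: IM.
rewrite !rmorphM /= e; congr (_ * _); rewrite scale_scale; apply: eq_subst => i.
congr (_ *: _); rewrite /supp_ind; case: eqP => [->|/eqP ai]; first by rewrite mulr0.
by rewrite mulVf.
Qed.

Lemma rescaled_homog : homog_closed rescaled.
Proof.
move=> d q [p Ip e]; exists (pihomog mdeg d p); first exact: Ih.
by rewrite -!pihomog_subst ?e // => i; apply: scale_homog.
Qed.

(** Balancedness survives the rescaling: the terms of [q] at the indicator vector are those
    of [p] at [a].  The exponents [e m] only serve to twist the terms by powers of [t]. *)
Lemma rescaled_root q : rescaled q ->
  exists2 t, f t = hone & exists (s : seq 'X_{1..n.+1}) (e : 'X_{1..n.+1} -> nat),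
    [/\ uniq s, \sum_(m <- s) (q@_m * \prod_i supp_ind i ^+ m i) * t ^+ e m = 0 &
      forall m, m \notin s -> q@_m * \prod_i supp_ind i ^+ m i = 0].
Proof.
case=> p Ip e; have [t ft t0] := balanced_root fR (msupp_uniq p) (Ia Ip).
have qp m : q@_m * \prod_i supp_ind i ^+ m i = p@_m * \prod_i a i ^+ m i.
  by rewrite -!mcoeff_scale e.
exists t => //; exists (msupp p), (fun m => index m (msupp p)).
split=> [||m /memN_msupp_eq0 pm]; first exact: msupp_uniq.
  by rewrite -[RHS]t0; apply: eq_bigr => m _; rewrite qp.
by rewrite qp pm mul0r.
Qed.

Let supp_ind_int (O : subringClosed F) i : supp_ind i \in O.
Proof. by rewrite /supp_ind; case: eqP; rewrite ?rpred0 ?rpred1. Qed.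

Let supp_coef_int (O : subringClosed F) q m :
  q \is a mpolyOver n.+1 O -> q@_m * \prod_i supp_ind i ^+ m i \in O.
Proof.
move=> /mpolyOverP qO; rewrite rpredM // rpred_prod // => i _.
by rewrite rpredX ?supp_ind_int.
Qed.

(** The powers of [t] in [1 + m] are congruent to [1], so the twisted sum of the terms of
    [q] is congruent to [q (c)]. *)
Lemma one_units_center (O : subringClosed F) :
    valuation_ring O -> (forall x : F, f x = hone <-> vmax O (x - 1)) ->
  forall q, rescaled q -> q \is a mpolyOver _ O -> vmax O q.@[supp_ind].
Proof.
move=> Ov OU q qJ qO; have [t /OU tm [s [e [us st0 qs]]]] := rescaled_root qJ.
have tO k : vmax O (1 - t ^+ k).
  elim: k => [|k IHk]; first by rewrite expr0 subrr vmax0.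
  have -> : 1 - t ^+ k.+1 = (1 - t ^+ k) - t ^+ k * (t - 1).
    by rewrite exprSr; ring.
  apply: vmaxB => //; apply: vmaxMl => //; rewrite rpredX //.
  by rewrite -(subrK 1 t) rpredD ?rpred1 ?vmax_int.
have -> : q.@[supp_ind] = \sum_(m <- s) q@_m * \prod_i supp_ind i ^+ m i.
  rewrite mevalE; set g := fun m : 'X_{1..n.+1} => q@_m * \prod_i supp_ind i ^+ m i.
  have nz r : \sum_(m <- r) g m = \sum_(m <- [seq m <- r | g m != 0]) g m.
    by rewrite big_filter (bigID (fun m => g m == 0)) /= big1 ?add0r // => m /eqP.
  rewrite [LHS](nz (msupp q)) [RHS](nz s); apply: perm_big.
  apply: uniq_perm; rewrite ?filter_uniq ?msupp_uniq // => m.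
  rewrite !mem_filter; apply: andb_id2l => gm.
  rewrite (contraNT _ gm : m \in s) => [|/qs gm0]; last by apply/eqP.
  by rewrite mcoeff_msupp; apply: contraNneq gm => qm; rewrite /g qm mul0r.
rewrite -[X in vmax O X]subr0 -[X in vmax O (_ - X)]st0 -sumrB.
apply: (big_ind (vmax O)) => [||m _]; [exact: vmax0|exact: vmaxD|].
rewrite -{1}[q@_m * _]mulr1 -mulrBr; apply: vmaxMl; last exact: tO.
exact: supp_coef_int.
Qed.

(** A [q] congruent to a power of the monomial [X^m0] has a single term which is a unit
    at the indicator vector; the twisted sum of its terms would be a unit.  The
    Nullstellensatz then gives a residue point where [X^m0] does not vanish. *)
Lemma units_center (O : subringClosed F) :
    valuation_ring O -> (forall x : F, f x = hone <-> x \in O /\ ~~ vmax O x) ->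
  exists c, [/\ forall i, c i \in O, forall i, a i != 0 -> ~~ vmax O (c i) &
    forall q, rescaled q -> q \is a mpolyOver _ O -> vmax O q.@[c]].
Proof.
move=> Ov OU.
pose m0 : 'X_{1..n.+1} := [multinom nat_of_bool (a i != 0%R) | i < n.+1].
have m0E i : m0 i = (a i != 0) by rewrite mnmE.
have [||c [cO cm0 cJ]] := @residue_point F O n.+1 rescaled 'X_[m0] Ov rescaled_ideal.
- exact: mpolyOverX.
- move=> N q qJ qO qm; have [t /OU[tO tu] [s [e [us st0 qs]]]] := rescaled_root qJ.
  pose M : 'X_{1..n.+1} := (m0 *+ N)%MM.
  have qM : vmax O (q@_M - 1).
    by have := qm M; rewrite mcoeffB mcoeffXn eqxx.
  have qm' m : m != M -> vmax O q@_m.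
    move=> mM; have := qm m; rewrite mcoeffB mcoeffXn eq_sym (negPf mM) subr0.
    exact.
  have indM : \prod_i supp_ind i ^+ M i = 1.
    apply: big1 => i _; rewrite mulmnE m0E /supp_ind.
    by case: eqP => _; rewrite ?mul0n ?expr0 ?expr1n.
  have qM1 : ~~ vmax O q@_M.
    apply/negP => qMm; have := vmaxB Ov qMm qM.
    by rewrite opprB addrC subrK vmax1.
  have Ms : M \in s.
    apply: contraT => /qs; rewrite indM mulr1 => qM0.
    by rewrite qM0 vmax0 in qM1.
  move: st0; rewrite (bigD1_seq M) //= indM mulr1 => /eqP.
  rewrite addr_eq0 => /eqP eM; case/negP: qM1.
  have [t0 tVO] := vmaxPn _ _ tu.
  rewrite -(mulfK (expf_neq0 (e M) t0) q@_M) eM.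
  apply: vmaxMr; first by rewrite -exprVn rpredX.
  apply: vmaxN; apply: (big_ind (vmax O)) => [||m mM]; [exact: vmax0|exact: vmaxD|].
  apply: vmaxMr; first exact: rpredX.
  apply: vmaxMr; last exact: qm'.
  by rewrite rpred_prod // => i _; rewrite rpredX ?supp_ind_int.
exists c; split=> // i ai.
apply: contra cm0 => ci; rewrite mevalX (bigD1 i) //= m0E ai expr1.
by apply: vmaxMr => //; rewrite rpred_prod // => k _; apply: rpredX.
Qed.

Lemma fiber_center (j : 'I_n.+1) : a j != 0 ->
  exists (O : subringClosed F) (c : 'I_n.+1 -> F),
  [/\ valuation_ring O, forall i, c i \in O, ~~ vmax O (c j),
    forall p, rescaled p -> p \is a mpolyOver _ O -> vmax O p.@[c] &
    forall i x, a i != 0 -> vmax O (x - c i) -> f x = hone].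
Proof.
move=> aj; have [O [Ov [OU|OU]]] := fiber_valuation fR; exists O.
  exists supp_ind; split=> //.
  - by rewrite /supp_ind aj vmax1.
  - exact: one_units_center.
  by move=> i x ai; rewrite /supp_ind ai => /OU.
have [c [cO cu cJ]] := units_center Ov OU.
exists c; split=> // [|i x ai xc]; first exact: cu.
apply/OU; have xE : x = c i + (x - c i) by rewrite addrC subrK.
split; first by rewrite xE rpredD // vmax_int.
by rewrite xE vmaxDl_unit // cu.
Qed.

(** The zero of [I] is [(a_i x_i)], with [x] a zero of the rescaled ideal congruent to [c]. *)
Lemma fiber_lift (j : 'I_n.+1) : a j != 0 ->
  exists b : 'I_n.+1 -> F, (forall i, f (b i) = f (a i)) /\ forall p, I p -> p.@[b] = 0.
Proof.
move=> aj; have [O [c [Ov cO cj cJ cf]]] := fiber_center aj.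
have [x [xc xJ]] := lift_point Ov rescaled_ideal rescaled_homog cO cj cJ.
exists (fun i => a i * x i); split=> [i|p Ip].
  rewrite [LHS](homM f (a i) (x i)); have [->|ai] := eqVneq (a i) 0.
    by rewrite -[0 : F]/(@hzero (field_hyperfield F)) hom0 hmul0.
  by rewrite (cf i (x i)) // hmulC hmul1.
have := xJ (subst (fun i => a i *: 'X_i) p); rewrite meval_subst.
have -> : p.@[fun i => (a i *: 'X_i).@[x]] = p.@[fun i => a i * x i].
  by apply: meval_eq => i; rewrite mevalZ mevalXU.
apply; exists p => //; rewrite scale_scale; apply: eq_subst => i.
by rewrite supp_indK.
Qed.

End FiberLift.

Lemma rel_alg_closed_surj (H1 H2 : hyperfield) (f : hyperhom H1 H2) (n : nat)
  (b : 'I_n -> H2) : rel_alg_closed f -> exists a, b = fun i => f (a i).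
Proof.
case=> fS _; have [a ea] := choice (fun i => fS (b i)).
by exists a; apply/funext => i; rewrite ea.
Qed.

Theorem theorem4p4 (F : closedFieldType) (H : hyperfield)
    (f : hyperhom (field_hyperfield F) H) (n : nat)
    (I : set {mpoly F[n.+1]}) :
  rel_alg_closed f -> homogeneous_ideal I ->
  proj_map f @` proj_variety (ideal_hmpoly I) = proj_variety (ideal_push f I).
Proof.
move=> fR [Iid Ih].
have fzero (a : 'I_n.+1 -> F) i : f (a i) = hzero -> a i = 0.
  by move=> fa; apply: contrapT => /(hom_neq0 (f := f)).
apply/seteqP; split=> [_ [x [a [aI a0 xa]] <-]|y [b [bI b0 yb]]].
  exists (f \o a); split.
  - move=> _ [_ [p Ip <-] <-]; apply/hmroots_push/balanced_sum0.
    have : hmroots (hmpoly_of p) a by apply: aI; exists p.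
    by rewrite /hmroots /= hmeval_field /= big_map => /esym; rewrite mevalE.
  - move=> fa0; apply: a0; apply/funext => i; apply: fzero.
    exact: (congr1 (@^~ i) fa0).
  by rewrite /= xa proj_map_class.
have [a eb] := rel_alg_closed_surj b fR.
have [j aj] : exists j, a j != 0.
  apply: contrapT => na; apply: b0; rewrite eb; apply/funext => i.
  have -> : a i = 0 by apply/eqP/contraT => ai; case: na; exists i.
  exact: (hom0 f).
have Ia p : I p -> balanced f [seq p@_m * \prod_i a i ^+ m i | m <- msupp p].
  move=> Ip; apply/hmroots_push; rewrite -eb; apply: bI.
  by exists (hmpoly_of p) => //; exists p.
have [c [fc Ic]] := fiber_lift fR Iid (fun d p => Ih p d) Ia aj.
have c0 : c <> (fun=> @hzero (field_hyperfield F)).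
  move=> ec; case/eqP: aj; apply: fzero.
  by rewrite -fc ec; apply: (hom0 f).
pose x : proj_space (field_hyperfield F) n :=
  exist _ (proj_class (H := field_hyperfield F) c) (ex_intro2 _ _ c c0 erefl).
exists x.
  exists c; split=> // _ [p Ip <-].
  by rewrite /hmroots /= hmeval_field /= Ic.
apply: eq_sig_hprop => [? ? ?|]; first exact: Prop_irrelevance.
rewrite /= proj_map_class yb eb; congr (proj_class _).
by apply/funext => i /=; rewrite fc.
Qed.
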